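(* Suppose that $D>d$ are positive integers. For any nontrivial finite alphabets $A,B$, the group $\mathrm{Aut}(A^{\mathbb{Z}^D})$ has a finitely generated subgroup that does not embed in $\mathrm{Aut}(B^{\mathbb{Z}^d})$.
   Context: An alphabet is a finite set; it is nontrivial if it has at least two elements. For a countable group $G$, $A^G$ has the product topology and the continuous $G$-action $(gx)_h=x_{g^{-1}h}$; $\mathrm{Aut}(A^G)$ is the group (under composition) of $G$-equivariant homeomorphisms $A^G\to A^G$ (reversible cellular automata). ''Embeds'' means as an abstract group, via an injective homomorphism. *)

(* Defs.v *)
From HB Require Import structures.
From mathcomp Require Import all_boot all_order all_algebra.
From mathcomp Require Import all_classical topology.
Set Implicit Arguments.
Unset Strict Implicit.
Unset Printing Implicit Defensive.
Import GRing.Theory.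
Local Open Scope classical_set_scope.
Local Open Scope ring_scope.

Section Configurations.
Variables (A : finType) (G : zmodType).

Definition config := {ptws G -> discrete_topology A}.

(* the left action (g x)_h = x_{g^-1 h}, in additive notation *)
Definition shift (g : G) (x : config) : config := fun h => x (- g + h).

Definition equivariant (f : config -> config) :=
  forall g, {morph f : x / shift g x}.

End Configurations.

Definition homeomorphism (X Y : topologicalType) (f : X -> Y) :=
  exists g : Y -> X, [/\ cancel f g, cancel g f, continuous f & continuous g].

Section ReversibleCA.
Variables (A : finType) (G : zmodType).
Local Notation X := (config A G).

Record RCA := MkRCA {
  rca_fun :> X -> X;
  rca_prop : `[< equivariant rca_fun /\ homeomorphism rca_fun >] }.

HB.instance Definition _ := [isSub for rca_fun].
HB.instance Definition _ := [Choice of RCA by <:].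

Fact rca_id_subproof : `[< equivariant (@id X) /\ homeomorphism (@id X) >].
Proof. by apply/asboolP; split=> //; exists id; split=> // x. Qed.

Fact rca_comp_subproof (f g : RCA) :
  `[< equivariant (f \o g) /\ homeomorphism (f \o g) >].
Proof.
apply/asboolP.
have /asboolP[ef [f' [fK f'K cf cf']]] := rca_prop f.
have /asboolP[eg [g' [gK g'K cg cg']]] := rca_prop g.
split; first by move=> s x /=; rewrite eg ef.
exists (g' \o f'); split; [exact: can_comp|exact: can_comp| |] => x.
  exact: (continuous_comp (cg x) (cf _)).
exact: (continuous_comp (cf' x) (cg' _)).
Qed.

Fact rca_inv_subproof (f : RCA) : {g : X -> X | [/\ cancel f g, cancel g f
  & `[< equivariant g /\ homeomorphism g >]]}.
Proof.
apply: cid; have /asboolP[ef [g [fK gK cf cg]]] := rca_prop f.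
exists g; split=> //; apply/asboolP; split; last by exists f.
by move=> s x; rewrite -{1}(gK x) -ef fK.
Qed.

Definition rca_one := MkRCA rca_id_subproof.
Definition rca_mul f g := MkRCA (rca_comp_subproof f g).
Definition rca_inv f :=
  let: exist g (And3 _ _ gP) := rca_inv_subproof f in MkRCA gP.

Fact rca_mulA : associative rca_mul.
Proof. by move=> f g h; apply/val_inj. Qed.

Fact rca_mul1 : left_id rca_one rca_mul.
Proof. by move=> f; apply/val_inj. Qed.

Fact rca_mulr1 : right_id rca_one rca_mul.
Proof. by move=> f; apply/val_inj. Qed.

Fact rca_mulV : left_inverse rca_one rca_inv rca_mul.
Proof.
move=> f; apply/val_inj/funext => x; rewrite /rca_inv.
by case: rca_inv_subproof => g [fK gK gP] /=; rewrite fK.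
Qed.

Fact rca_mulrV : right_inverse rca_one rca_inv rca_mul.
Proof.
move=> f; apply/val_inj/funext => x; rewrite /rca_inv.
by case: rca_inv_subproof => g [fK gK gP] /=; rewrite gK.
Qed.

HB.instance Definition _ :=
  isGroup.Build RCA rca_mulA rca_mul1 rca_mulr1 rca_mulV rca_mulrV.

End ReversibleCA.

Definition generated_subgroup (G : groupType) (S : set G) : set G :=
  smallest [set H : set G | group_closed (mem H)] S.

Definition finitely_generated (G : groupType) :=
  exists s : seq G, generated_subgroup [set` s] = [set: G].

Definition embeds (G H : groupType) :=
  exists f : {multiplicative G -> H}, injective f.

(* Main.v *)
(* Call (X_v), (Z_v), g a Heisenberg family of rank N if these are involutions,
   the X's commute, the Z's commute, g is central, and [X_v, Z_w] = g or 1
   according to whether v = w. When such a family acts on a set and g moves a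
   point, let F_2^N act through the X's and through the Z's: the two stabilizers
   of that point are orthogonal, so one of its orbits has at least 2^(N/2) points.
   In Aut(B^(Z^d)) a nontrivial element of word length n in given generators has
   radius O(n), hence moves a configuration of period O(n), of which there are
   only exp(O(n^d)). So N = O(n^d) as soon as g has word length n.

   In dimension D there is a finitely generated group containing, for n = 2^m - 1,
   a Heisenberg family of rank n^D whose center g has word length O(n). Encode
   bit tracks in nonoverlapping marked words and let f(p) say that p is the
   corner of a decorated box of side n; the decoration forces boxes with distinct
   corners to be disjoint. Then g adds f to a track c, X_v adds f(p) to a track
   u at p + v, and Z_v adds f(p) u(p + v) to c. That g has length O(n) comes from
   products along lines, which are entries of powers of a 2 x 2 matrix h with
   h^2 = a h + 1 in characteristic 2, and an induction on the dimension. *)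
Require Import Defs.
From HB Require Import structures.
From mathcomp Require Import all_boot all_order all_algebra mxabelem.
From mathcomp Require Import all_classical topology.
From mathcomp Require Import zify.
Set Implicit Arguments.
Unset Strict Implicit.
Unset Printing Implicit Defensive.
Import Order.TTheory GRing.Theory Num.Theory.
Local Open Scope ring_scope.

(** * Actions of Heisenberg families on finite sets *)

Section HeisenbergOrbit.
Variables (Omega : finType) (N : nat) (X Z : 'I_N -> Omega -> Omega).
Variable g : Omega -> Omega.
Hypothesis XK : forall i, involutive (X i).
Hypothesis ZK : forall i, involutive (Z i).
Hypothesis gK : involutive g.
Hypothesis XC : forall i j y, X i (X j y) = X j (X i y).
Hypothesis ZC : forall i j y, Z i (Z j y) = Z j (Z i y).
Hypothesis gX : forall i y, g (X i y) = X i (g y).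
Hypothesis gZ : forall i y, g (Z i y) = Z i (g y).
Hypothesis XZ : forall i j y,
  X i (Z j y) = Z j (X i (if i == j then g y else y)).

Local Notation vec := 'rV[bool]_N.

(** Here [bool] is the field F_2, with exclusive or as sum, so [vec] is F_2^N. The action runs along
    a list to allow induction; [enum 'I_N] gives all of it. *)
Definition vact (F : 'I_N -> Omega -> Omega) (l : seq 'I_N) (s : vec) y :=
  foldr (fun i z => if s 0 i then F i z else z) y l.

Definition gpow (b : bool) y := if b then g y else y.

Lemma vact_comm F l s h y :
  (forall i z, h (F i z) = F i (h z)) -> h (vact F l s y) = vact F l s (h y).
Proof. by move=> hF; elim: l => //= i l IH; case: ifP => _; rewrite ?hF IH. Qed.

Lemma vactD F l s t y : (forall i, involutive (F i)) ->
  (forall i j z, F i (F j z) = F j (F i z)) ->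
  vact F l (s + t) y = vact F l s (vact F l t y).
Proof.
move=> FK FC; elim: l => //= i l IH; rewrite mxE IH.
case: (s 0 i) (t 0 i) => -[] //=; last by rewrite (@vact_comm F l s (F i)).
by rewrite -(@vact_comm F l s (F i)) ?FK.
Qed.

Lemma gpowD a b y : gpow (a + b) y = gpow a (gpow b y).
Proof. by case: a b => -[] //=; rewrite /gpow /= gK. Qed.

Lemma gpow_comm b (F : 'I_N -> Omega -> Omega) : (forall i y, g (F i y) = F i (g y)) ->
  forall i y, gpow b (F i y) = F i (gpow b y).
Proof. by move=> gF i y; rewrite /gpow; case: b. Qed.

(** Passing [X i] through [Z j] leaves a factor [g] only when [i = j]; [g] is a central involution,
    so these factors add up to an exponent in F_2. *)
Lemma X_vactZ i l t y :
  X i (vact Z l t y) = gpow (\sum_(j <- l) t 0 j * (i == j)) (vact Z l t (X i y)).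
Proof.
elim: l => [|j l IH] /=; first by rewrite big_nil.
rewrite big_cons; case: (t 0 j); last by rewrite mul0r add0r IH.
rewrite XZ mul1r gpowD (gpow_comm _ gZ) -IH /gpow.
by case: eqP => _ //; rewrite gZ gX.
Qed.

Lemma vactX_vactZ l l' s t y : vact X l s (vact Z l' t y) =
  gpow (\sum_(i <- l) \sum_(j <- l') s 0 i * (t 0 j * (i == j)))
    (vact Z l' t (vact X l s y)).
Proof.
elim: l => [|i l IH] /=; first by rewrite big_nil.
rewrite big_cons -mulr_sumr IH; case: (s 0 i); last by rewrite mul0r add0r.
by rewrite mul1r gpowD -(gpow_comm _ gX) X_vactZ -!gpowD addrC.
Qed.

Variable x : Omega.
Hypothesis gx : g x != x.

Definition stab F := [set s : vec | vact F (enum 'I_N) s x == x].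

(** The commutator of the two elements is [g] to the power of their scalar product. It fixes [x],
    which [g] moves. *)
Lemma stab_orth s t : s \in stab X -> t \in stab Z -> s *m t^T = 0.
Proof.
rewrite !inE => /eqP sx /eqP tx; apply/matrixP => i j; rewrite !ord1 !mxE.
have := vactX_vactZ (enum 'I_N) (enum 'I_N) s t x; rewrite sx !tx sx.
rewrite (_ : \sum_(i <- _) _ = \sum_j0 s 0 j0 * t^T j0 0); last first.
  rewrite big_enum /=; apply: eq_bigr => k _; rewrite big_enum /=.
  rewrite (bigD1 k) //= eqxx mulr1 big1 ?addr0 ?mxE // => l.
  by rewrite eq_sym => /negPf->; rewrite !mulr0.
rewrite /gpow; case: (\sum_j0 _) => // /esym/eqP; by rewrite (negPf gx).
Qed.

(** Vectors sending [x] to the same point differ by stabilizer elements, so each fibre of the orbit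
    map injects into [stab F]. *)
Lemma card_stab F : (forall i, involutive (F i)) ->
  (forall i j z, F i (F j z) = F j (F i z)) ->
  (2 ^ N <= #|Omega| * #|stab F|)%N.
Proof.
move=> FK FC; have <- : #|[set: vec]| = (2 ^ N)%N.
  by rewrite cardsT card_mx mul1n card_bool.
rewrite -sum1_card (partition_big (fun s => vact F (enum 'I_N) s x) predT) //=.
rewrite -sum_nat_const; apply: leq_sum => y _.
rewrite sum1dep_card.
have [s sy|noy] := pickP (fun s => vact F (enum 'I_N) s x == y); last first.
  by rewrite eq_card0 // => s; rewrite !inE noy.
rewrite -(card_imset _ (@addrI _ s)); apply: subset_leq_card.
apply/fintype.subsetP => _ /finset.imsetP[t tF ->]; move: tF; rewrite !inE /= => ty.
rewrite vactD // (eqP ty) -(eqP sy) -vactD //.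
have -> : s + s = 0 by apply/rowP => i; rewrite !mxE; case: (s 0 i).
apply/eqP; rewrite /vact; elim: (enum _) => //= i l ->; by rewrite mxE.
Qed.

Lemma heisenberg_orbit : (2 ^ N <= #|Omega| ^ 2)%N.
Proof.
(* The rows of [M F] list the stabilizer, so its rank bounds the size of the stabilizer;
   orthogonality bounds the sum of the two ranks by [N]. *)
pose M F := \matrix_(i < #|stab F|) (enum_val i : vec).
have rkM F : (#|stab F| <= 2 ^ \rank (M F))%N.
  have -> : (2 ^ \rank (M F) = #|rowg (M F)|)%N by rewrite card_rowg card_bool.
  apply/subset_leq_card/fintype.subsetP => s sF; rewrite mem_rowg.
  by rewrite -(enum_rankK_in sF sF) -[X in (X <= _)%MS](rowK (fun i => enum_val i)) row_sub.
have rk : (\rank (M X) + \rank (M Z) <= N)%N.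
  rewrite -(mxrank_tr (M Z)) mulmx0_rank_max //.
  apply/matrixP => i j; rewrite [RHS]mxE.
  have := stab_orth (enum_valP i) (enum_valP j) => /matrixP/(_ 0 0).
  rewrite mxE [RHS]mxE => <-; rewrite mxE; apply: eq_bigr => k _.
  by rewrite !mxE.
have := leq_mul (card_stab XK XC) (card_stab ZK ZC).
rewrite mulnACA mulnn => /leq_trans/(_ (leq_mul (leqnn _) (leq_mul (rkM X) (rkM Z)))).
rewrite -expnD => /leq_trans/(_ (leq_mul (leqnn _) (leq_pexp2l _ rk))).
by rewrite leq_pmul2r ?expn_gt0 //; apply.
Qed.

End HeisenbergOrbit.

(** * Finite windows and continuity *)

Section Windows.
Local Open Scope classical_set_scope.
Variables (A : finType) (G : zmodType).
Local Notation X := (config A G).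

Definition agree_on (w : seq G) (x y : X) := {in w, forall h, x h = y h}.

Lemma agree_on_cat w w' x y :
  agree_on (w ++ w') x y -> agree_on w x y /\ agree_on w' x y.
Proof. by move=> xy; split=> h hw; apply: xy; rewrite mem_cat hw ?orbT. Qed.

Lemma window_nbhs (w : seq G) (x : X) : nbhs x [set y : X | agree_on w y x].
Proof.
elim: w => [|h w IH]; first by apply: filterS filterT => y _ k.
have xh : nbhs x [set y : X | y h = x h].
  have /(_ [set x h]) := @proj_continuous G (fun=> discrete_topology A) h x.
  by apply; exact: discrete_set1.
apply: filterS (filterI xh IH) => y [/= yh yw] k.
by rewrite inE => /orP[/eqP->|/yw].
Qed.

(** The sets containing a cylinder about [x] form a filter. The product topology is a supremum of
    coordinate topologies, so convergence of this filter to [x] is tested one coordinate at a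
    time. *)
Lemma nbhs_window (x : X) (U : set X) :
  nbhs x U -> exists w, forall y, agree_on w y x -> U y.
Proof.
pose F : set_system X := [set U | exists w, forall y, agree_on w y x -> U y].
have FF : Filter F.
  split; first by exists [::].
  - move=> P Q [w wP] [w' wQ]; exists (w ++ w') => y /agree_on_cat[yw yw'].
    by split; [exact: wP|exact: wQ].
  - by move=> P Q PQ [w wP]; exists w => y /wP/PQ.
suff : F --> x by apply.
apply/cvg_sup => h V [W] [[O] oO <-] Ox OV.
by exists [:: h] => y yx; apply: OV; rewrite /= yx ?mem_head.
Qed.

Lemma window_continuous (f : X -> X) :
  (forall q, exists w, forall x y, agree_on w x y -> f x q = f y q) ->
  continuous f.
Proof.
move=> fw x U /nbhs_window[w wU].
suff [v vw] : exists v, forall y, agree_on v y x -> agree_on w (f y) (f x).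
  by apply: filterS (window_nbhs v x) => y /vw/wU.
elim: w {wU} => [|q w [v vw]]; first by exists [::].
have [v' v'q] := fw q; exists (v' ++ v) => y /agree_on_cat[/v'q yx /vw ywx] h.
by rewrite inE => /orP[/eqP->|/ywx].
Qed.

(** The compactness half of the Curtis-Hedlund-Lyndon theorem: windows that work near each point are
    made uniform. *)
Lemma continuous_window (f : X -> X) (q : G) : continuous f ->
  exists w, forall x y, agree_on w x y -> f x q = f y q.
Proof.
(* Windows are directed by inclusion; compactness, in its near-covering form, yields one window that
   works at all points. *)
move=> cf; pose F : set_system (seq G) :=
  [set U | exists w : seq G, forall w' : seq G, {subset w <= w'} -> U w'].
have FF : Filter F.
  split; first by exists [::].
  - move=> P Q [w wP] [w' wQ]; exists (w ++ w') => v wv.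
    by split; [apply: wP|apply: wQ] => h hw; apply: wv; rewrite mem_cat hw ?orbT.
  - by move=> P Q PQ [w wP]; exists w => y /wP/PQ.
have cX : compact [set: X].
  have cA (h : G) : compact [set: discrete_topology A].
    by apply: finite_compact; exact: (@finite_finset A).
  by have := tychonoff cA; congr compact; apply/seteqP; split.
have /compact_near_coveringP/(_ _ F
  (fun w x => forall y, agree_on w y x -> f x q = f y q)) := cX.
rewrite /near_covering /=; case=> //.
  move=> x _.
  have : nbhs x [set y | f y q = f x q].
    have /(_ [set f x q]) := @proj_continuous G (fun=> discrete_topology A) q (f x).
    by move=> /(_ (discrete_set1 _))/(cf x).
  move=> /nbhs_window[w wx].
  exists ([set y | agree_on w y x], [set w' : seq G | {subset w <= w'}]) => /=.
    by split; [exact: window_nbhs|exists w].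
  move=> [y w'] /= [yx ww'] z zy; rewrite (wx y) // (wx z) // => h hw.
  by rewrite zy ?yx //; apply: ww'.
move=> w /(_ w (fun _ => id)) wP; exists w => x y xy; apply: wP => // h hw.
by rewrite xy.
Qed.

End Windows.

(** * Word length and Heisenberg families in abstract groups *)

Section Words.
Variable T : groupType.
Implicit Types (S s : seq T) (g h : T).

Definition wprod s : T := foldr (fun x y => (x * y)%g) 1%g s.

Definition word S n g :=
  exists s, [/\ (size s <= n)%N, {subset s <= S} & g = wprod s].

Lemma wprod_cat s t : wprod (s ++ t) = (wprod s * wprod t)%g.
Proof. by elim: s => [|x s IH] /=; rewrite ?mul1g // IH mulgA. Qed.

Lemma wordM S m n g h : word S m g -> word S n h -> word S (m + n) (g * h)%g.
Proof.
move=> [s [sm sS ->]] [t [tn tS ->]]; exists (s ++ t); rewrite wprod_cat.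
split=> //; first by rewrite size_cat leq_add.
by move=> x; rewrite mem_cat => /orP[/sS|/tS].
Qed.

Lemma wordS S m n g : (m <= n)%N -> word S m g -> word S n g.
Proof. by move=> mn [s [sm sS ->]]; exists s; split=> //; exact: leq_trans mn. Qed.

Lemma word_gen S g : g \in S -> word S 1 g.
Proof.
move=> gS; exists [:: g]; split; rewrite //= ?mulg1 // => x.
by rewrite inE => /eqP->.
Qed.

Lemma wordX S m n g : word S m g -> word S (m * n) (g ^+ n)%g.
Proof.
move=> gS; elim: n => [|n IH]; first by rewrite muln0; exists [::].
by rewrite expgS mulnS; exact: wordM.
Qed.

Lemma wordV S n g : (forall x, x \in S -> x * x = 1)%g ->
  word S n g -> word S n g^-1%g.
Proof.
move=> SV [s [sn sS ->]]; exists (rev s); split; first by rewrite size_rev.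
  by move=> x; rewrite mem_rev; exact: sS.
elim: s sS {sn} => [|x s IH] sS /=; first by rewrite invg1.
rewrite invgM IH => [|y ys]; last by apply: sS; rewrite inE ys orbT.
rewrite rev_cons -cats1 wprod_cat /= mulg1; congr (_ * _)%g.
by apply/esym/(mulgI x); rewrite mulgV SV // sS ?mem_head.
Qed.

Record heisenberg N (X Z : 'I_N -> T) (g : T) : Prop := Heisenberg {
  heisXX : forall i, (X i * X i = 1)%g;
  heisZZ : forall i, (Z i * Z i = 1)%g;
  heisgg : (g * g = 1)%g;
  heisXC : forall i j, (X i * X j = X j * X i)%g;
  heisZC : forall i j, (Z i * Z j = Z j * Z i)%g;
  heisgX : forall i, (g * X i = X i * g)%g;
  heisgZ : forall i, (g * Z i = Z i * g)%g;
  heisXZ : forall i j, (X i * Z j = Z j * (X i * (if i == j then g else 1)))%g }.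

End Words.

Section Morphism.
Variables (T U : groupType) (f : {multiplicative T -> U}).

Lemma morph1 : f 1%g = 1%g.
Proof. by apply: (mulgI (f 1%g)); rewrite -gmulfM !mulg1. Qed.

Lemma word_morph S n g : word S n g -> word (map f S) n (f g).
Proof.
move=> [s [sn sS ->]]; exists (map f s); split; first by rewrite size_map.
  by move=> _ /mapP[x /sS xS ->]; exact: map_f.
by elim: s {sn sS} => [|x s IH] /=; rewrite ?morph1 // gmulfM IH.
Qed.

Lemma heisenberg_morph N (X Z : 'I_N -> T) g : heisenberg X Z g ->
  heisenberg (f \o X) (f \o Z) (f g).
Proof.
case=> XX ZZ gg XC ZC gX gZ XZ; split=> *; rewrite /= -?gmulfM.
- by rewrite XX morph1.
- by rewrite ZZ morph1.
- by rewrite gg morph1.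
- by rewrite XC.
- by rewrite ZC.
- by rewrite gX.
- by rewrite gZ.
- by rewrite XZ !gmulfM; case: ifP; rewrite ?morph1.
Qed.

End Morphism.

(** * Radius of automorphisms and their action on periodic configurations *)

Section Radius.
Variables (B : finType) (d : nat).
Local Notation G := 'rV[int]_d.
Local Notation X := (config B G).
Local Notation RCA := (RCA B G).

(** Locality is imposed at the origin only, in the sup norm; equivariance carries it to every
    cell. *)
Definition radius r (f : X -> X) := forall x y : X,
  (forall h : G, (forall i, (`|h 0%R i| <= r)%N) -> x h = y h) -> f x 0 = f y 0.

Lemma rca_equivariant (f : RCA) : equivariant f.
Proof. by have /asboolP[] := rca_prop f. Qed.

Lemma rca_continuous (f : RCA) : continuous f.
Proof. by have /asboolP[_ [g []]] := rca_prop f. Qed.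

Lemma rcaM (f g : RCA) x : (f * g)%g x = f (g x).
Proof. by []. Qed.

Lemma radius_ex (f : RCA) : exists r, radius r f.
Proof.
have [w wP] := continuous_window 0 (@rca_continuous f).
exists (\max_(h <- w) \max_i `|h 0%R i|)%N => x y xy; apply: wP => h hw.
by apply: xy => i; rewrite (big_rem h) //= leq_max (leq_bigmax i).
Qed.

Lemma radius_at r (f : X -> X) (q : G) (x y : X) : equivariant f -> radius r f ->
  (forall h : G, (forall i, (`|h 0%R i - q 0%R i| <= r)%N) -> x h = y h) ->
  f x q = f y q.
Proof.
move=> ef rf xy; have E z : f z q = f (shift (- q) z) 0.
  by rewrite ef /shift addr0 opprK.
rewrite !E; apply: rf => h hr; apply: xy => i.
by rewrite opprK !mxE addrAC subrr add0r.
Qed.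

Lemma radius_comp r s (f g : X -> X) : equivariant g ->
  radius r f -> radius s g -> radius (r + s) (f \o g).
Proof.
move=> eg rf rg x y xy /=; apply: rf => h hr; apply: (radius_at eg rg) => k ks.
apply: xy => i; have := leq_add (hr i) (ks i); move: (h 0 i) (k 0 i) => a b; lia.
Qed.

Lemma radiusS r s f : (r <= s)%N -> radius r f -> radius s f.
Proof.
move=> rs rf x y xy; apply: rf => h hr; apply: xy => i; exact: leq_trans (hr i) rs.
Qed.

(** Radii add under composition, so a common radius of the generators serves as [C]. *)
Lemma radius_word (S : seq RCA) :
  exists C, forall n (g : RCA), word S n g -> radius (n * C) g.
Proof.
have [C SC] : exists C, forall f : RCA, f \in S -> radius C f.
  elim: S => [|f S [C SC]]; first by exists 0%N.
  have [r fr] := radius_ex f; exists (maxn r C) => h.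
  rewrite inE => /orP[/eqP->|/SC]; first exact: radiusS (leq_maxl _ _) fr.
  exact: radiusS (leq_maxr _ _).
exists C => n _ [s [sn sS ->]].
apply: (@radiusS (size s * C)); first by rewrite leq_mul2r sn orbT.
elim: s sS {sn} => [|f s IH] sS /=.
  by move=> x y xy; apply: xy => i; rewrite mxE.
rewrite mulSn; apply: radius_comp.
- exact: rca_equivariant.
- by apply: SC; apply: sS; rewrite mem_head.
- by apply: IH => g gs; apply: sS; rewrite inE gs orbT.
Qed.

Section Periodic.
Variable L : nat.
Local Notation torus := 'rV['I_L.+2]_d.
Local Notation Omega := {ffun torus -> B}.

Let proj (h : G) : torus := map_mx intr h.
Let sect (t : torus) : G := map_mx (fun z : 'I_L.+2 => (z : nat)%:Z) t.

Lemma sectK : cancel sect proj.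
Proof. by move=> t; apply/rowP => i; rewrite !mxE -pmulrn natr_Zp. Qed.

Definition unroll (w : Omega) : X := fun h => w (proj h).
Definition restr (x : X) : Omega := [ffun t => x (sect t)].
Definition torus_act (f : X -> X) (w : Omega) := restr (f (unroll w)).

(** Unrolled configurations are invariant under the period lattice, and [f] commutes with its
    translations. *)
Lemma unroll_act f w : equivariant f -> unroll (torus_act f w) = f (unroll w).
Proof.
move=> ef; apply/funext => h; rewrite /unroll ffunE.
set g := h - sect (proj h).
have gw : shift g (unroll w) = unroll w.
  apply/funext => k; rewrite /shift /unroll; congr (w _).
  have pD a b : proj (a + b) = proj a + proj b by exact: map_mxD.
  have pN a : proj (- a) = - proj a by exact: map_mxN.
  by rewrite pD pN /g pD pN sectK subrr oppr0 add0r.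
have := congr1 (fun x : X => x h) (ef g (unroll w)).
by rewrite gw /shift => ->; congr (f _ _); rewrite opprB subrK.
Qed.

Lemma torus_actM (f g : RCA) w :
  torus_act (f * g)%g w = torus_act f (torus_act g w).
Proof.
by rewrite {2}/torus_act unroll_act //; exact: rca_equivariant.
Qed.

Lemma torus_act1 w : torus_act (1%g : RCA) w = w.
Proof. by apply/ffunP => t; rewrite ffunE [LHS]/= /unroll /= sectK. Qed.

End Periodic.

(** A cell changed by [f] is translated to [(R, ..., R)]. Its window then has coordinates in
    [[0, 2R]], inside one fundamental domain, and survives the wrapping onto the torus. *)
Lemma torus_act_faithful R (f : RCA) : radius R f -> f != 1%g ->
  exists w : {ffun 'rV['I_(2 * R).+2]_d -> B}, torus_act f w != w.
Proof.
move=> rf f1; have ef := @rca_equivariant f.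
have [x fx] : exists x, f x <> x.
  apply/existsNP => fid; case/eqP: f1; apply/val_inj/funext => x; exact: fid.
have [q fq] : exists q, f x q <> x q.
  by apply/existsNP => fid; apply: fx; apply/funext.
pose c : G := const_mx R%:Z.
pose y := shift (c - q) x.
have yc : f y c != y c.
  by apply/eqP; rewrite /y ef /shift opprB subrK.
exists (restr _ y); apply: contraNneq yc => yw.
have u (h : G) : (forall i, (`|h 0%R i - c 0%R i| <= R)%N) -> unroll (restr (2 * R) y) h = y h.
  move=> hR; rewrite /unroll ffunE; congr y; apply/rowP => i; rewrite !mxE.
  move: (hR i); rewrite mxE; case: (h 0 i) => [n|n] nR; last by exfalso; lia.
  by rewrite -pmulrn Zp_nat /= modn_small //; lia.
have -> : f y c = f (unroll (restr (2 * R) y)) c.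
  by apply: radius_at rf _ => // h /u.
by rewrite -unroll_act // yw u // => i; rewrite subrr.
Qed.

(** Since [g] has radius [n * C], it moves a configuration of the torus of side [2 * (n * C) + 2];
    these configurations form the finite set of the orbit bound. *)
Lemma heisenberg_rank_bound (S : seq RCA) : exists C, forall n N (Xf Zf : 'I_N -> RCA) g,
  word S n g -> g != 1%g -> heisenberg Xf Zf g ->
  (2 ^ N <= (#|B| ^ ((2 * (n * C)).+2 ^ d)) ^ 2)%N.
Proof.
have [C SC] := radius_word S; exists C => n N Xf Zf g gS g1 H.
have [w gw] := torus_act_faithful (SC _ _ gS) g1.
pose a (f : RCA) := @torus_act (2 * (n * C)) f.
have aE (f1 f2 f3 f4 : RCA) y : (f1 * f2 = f3 * f4)%g -> a f1 (a f2 y) = a f3 (a f4 y).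
  by rewrite /a -!torus_actM => ->.
have aV f : (f * f = 1)%g -> involutive (a f).
  by move=> ff y; rewrite /a -torus_actM ff torus_act1.
have := @heisenberg_orbit _ N (a \o Xf) (a \o Zf) (a g) _ _ _ _ _ _ _ _ w gw.
rewrite card_ffun card_mx mul1n card_ord; apply.
- by move=> i; exact/aV/(heisXX H).
- by move=> i; exact/aV/(heisZZ H).
- exact/aV/(heisgg H).
- by move=> i j y; exact/aE/(heisXC H).
- by move=> i j y; exact/aE/(heisZC H).
- by move=> i y; exact/aE/(heisgX H).
- by move=> i y; exact/aE/(heisgZ H).
- move=> i j y /=; rewrite (aE _ _ _ _ _ (heisXZ H i j)) /a torus_actM.
  by case: eqP => // _; rewrite torus_act1.
Qed.

End Radius.

(** * Generated subgroups as groups in their own right *)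

Section GeneratedSubgroup.
Variables (T : groupType) (S : seq T).

Definition in_gen : pred T := fun g => `[< generated_subgroup [set` S]%classic g >].

Lemma in_gen_closed : group_closed in_gen.
Proof.
split; first by apply/asboolP => H [Hcl HS]; have /set_mem := Hcl.1.
move=> x y /asboolP xS /asboolP yS; apply/asboolP => H [Hcl HS].
by apply/set_mem/Hcl.2; apply/mem_set; [exact: xS|exact: yS].
Qed.

Definition gen_group := {g : T | in_gen g}.
HB.instance Definition _ := SubChoice.on gen_group.
HB.instance Definition _ :=
  SubChoice_isSubGroup.Build T in_gen gen_group in_gen_closed.

Lemma in_gen_mem x : x \in S -> in_gen x.
Proof. by move=> xS; apply/asboolP => H [_]; apply. Qed.

Lemma word_in_gen n x : word S n x -> in_gen x.
Proof.
move=> [s [_ sS ->]]; elim: s sS => [|y s IH] sS /=.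
  exact: in_gen_closed.1.
apply: (group_closedM in_gen_closed).
  by apply: in_gen_mem; rewrite sS ?mem_head.
by apply: IH => z zs; rewrite sS // inE zs orbT.
Qed.

Let lift : seq gen_group := pmap insub S.

Lemma word_lift n (x : gen_group) : word S n (val x) -> word lift n x.
Proof.
move=> [s [sn sS xs]]; exists (pmap insub s).
have sE : map val (pmap insub s : seq gen_group) = s.
  rewrite (pmap_filter (insubK _)); apply/all_filterP/allP => y /sS yS.
  by rewrite insubT //; exact: in_gen_mem.
split.
- by rewrite -(size_map val) sE.
- by move=> y; rewrite !mem_pmap => /mapP[z /sS zS ->]; exact: map_f.
- apply/val_inj; rewrite xs -{1}sE; elim: (pmap _ _) => [|y t /= ->] //=.
Qed.

Lemma gen_group_fg : finitely_generated gen_group.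
Proof.
exists lift; apply/seteqP; split=> // h _ K [Kcl Ksub].
(* Minimality of the generated subgroup is available in [T], so [K] is replaced by its image
   there. *)
pose K' : set T := [set x | exists2 k : gen_group, K k & val k = x]%classic.
have [k Kk kh] : K' (val h).
  have /asboolP := valP h; apply; split.
    split; first by apply/mem_set; exists 1%g; [exact/set_mem/Kcl.1|].
    move=> _ _ /set_mem[k Kk <-] /set_mem[l Kl <-]; apply/mem_set.
    exists (k / l)%g; first by apply/set_mem/Kcl.2; apply/mem_set.
    by [].
  move=> x /= xS; exists (Sub x (in_gen_mem xS)) => //; apply: Ksub => /=.
  by rewrite mem_pmap; apply/mapP; exists x; rewrite // (insubT _ (in_gen_mem xS)).
by rewrite -(val_inj kh).
Qed.

End GeneratedSubgroup.

(** * Comparison of the growth rates *)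

Lemma rank_bound_fails (D d b C C' : nat) : (0 < d)%N -> (d < D)%N ->
  exists m, ((b ^ ((2 * (C * 2 ^ m * C')).+2 ^ d)) ^ 2 < 2 ^ ((2 ^ m).-1 ^ D))%N.
Proof.
(* [m] absorbs all constants, so that the left exponent is at most [m * 2 ^ (m * d)]. At [m.+1] the
   right one is at least [2 ^ (m * d.+1)], because [2 ^ m.+1 - 1 >= 2 ^ m]; then [m < 2 ^ m]
   decides. *)
move=> d0 dD; pose K := (2 * (C * C') + 2)%N; pose m := (b * 2 * (2 * K) ^ d)%N.
exists m.+1; set E := _.+2.
have EK : (E ^ d <= (2 * K) ^ d * 2 ^ (m * d))%N.
  rewrite expnM -expnMn leq_exp2r // /E /K expnS.
  have := expn_gt0 2 m; move: (2 ^ m)%N => M; nia.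
have bE : ((b ^ E ^ d) ^ 2 <= 2 ^ (m * 2 ^ (m * d)))%N.
  rewrite -expnM; apply: (@leq_trans ((2 ^ b) ^ (E ^ d * 2))%N).
    by rewrite leq_exp2r ?muln_gt0 ?expn_gt0 //; exact/ltnW/ltn_expl.
  rewrite -expnM leq_pexp2l //.
  have -> : (m * 2 ^ (m * d) = b * ((2 * K) ^ d * 2 ^ (m * d) * 2))%N.
    by rewrite {1}/m; move: (_ ^ d)%N (_ ^ (m * d))%N => u v; lia.
  by rewrite leq_mul2l leq_mul2r EK !orbT.
apply: leq_ltn_trans bE _; rewrite ltn_exp2l //.
apply: (@leq_trans (2 ^ (m * d.+1))%N).
  by rewrite mulnS expnD ltn_pmul2r ?expn_gt0 // ltn_expl.
apply: (@leq_trans (2 ^ (m * D))%N); first by rewrite leq_pexp2l // leq_mul2l dD orbT.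
rewrite expnM leq_exp2r ?(leq_trans _ dD) // expnS.
have := expn_gt0 2 m; move: (2 ^ m)%N => M; lia.
Qed.

(** * Marked words, data tracks and controlled toggles *)

Section Coding.
Variables (A : finType) (a0 a1 : A) (D : nat) (T : finType).
Local Notation G := 'rV[int]_D.+1.
Local Notation X := (config A G).
Implicit Types (x y : X) (p q : G) (j : T) (S : G -> bool) (phi : X -> bool).

Definition view x p : X := fun h => x (p + h).

Lemma view_shift x p : view x p = shift (- p) x.
Proof. by rewrite /shift opprK. Qed.

Lemma view_view x p q : view (view x p) q = view x (p + q).
Proof. by apply/funext => h; rewrite /view addrA. Qed.

Lemma view0 x : view x 0 = x.
Proof. by apply/funext => h; rewrite /view add0r. Qed.

Definition cell (o : nat) : G := delta_mx 0 0 *+ o.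

Lemma cell0 : cell 0 = 0.
Proof. exact: mulr0n. Qed.

Lemma cell_inj : injective cell.
Proof.
move=> o o' /(congr1 (fun p : G => p 0 0)).
by rewrite !mulmxnE !mxE !eqxx !natz => -[].
Qed.

(** Data sit at odd offsets from 3 on, which leaves the even offsets from 2 to [blen - 1] for
    zeros. *)
Definition off j : nat := (2 * enum_rank j + 3)%N.
Definition blen : nat := (2 * #|T| + 3)%N.

Lemma off_lt j : (off j < blen)%N.
Proof.
rewrite /off /blen; have : (enum_rank j < #|T|)%N := ltn_ord _.
by move: (nat_of_ord _) => i; move: #|T| => n; lia.
Qed.

Lemma off_inj : injective off.
Proof.
move=> i j ij; apply: enum_rank_inj; apply: val_inj => /=.
by move/eqP: ij; rewrite /off eqn_add2r eqn_pmul2l // => /eqP.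
Qed.

(* A marked cell carries the word [1 1 0 (d 0)^r] along the first axis, with one
   data symbol [d] per track. Since [1 1] occurs only at its start, two marked
   words never overlap, so data can be toggled without disturbing the marks. *)
Definition marked x : bool := [&& x 0 == a1, x (cell 1) == a1,
  [forall i : 'I_(#|T|.+1), x (cell (2 * i + 2)) == a0] &
  [forall j : T, x (cell (off j)) \in [:: a0; a1]]].

Definition bit j x : bool := marked x && (x (cell (off j)) == a1).

Hypothesis a01 : a0 != a1.

Definition sw (a : A) := if a == a0 then a1 else if a == a1 then a0 else a.

Lemma swK : involutive sw.
Proof.
move=> a; rewrite /sw; have [->|na0] := eqVneq a a0.
  by rewrite eqxx eq_sym (negPf a01).
by have [->|na1] := eqVneq a a1; rewrite ?eqxx // (negPf na0) (negPf na1).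
Qed.

(** [p] is the only cell whose word could have its track [j] symbol at [q]; [S] selects the words to
    flip. *)
Definition flip j S x : X := fun q =>
  let p := q - cell (off j) in if marked (view x p) && S p then sw (x q) else x q.

Lemma marked_ext x y :
  (forall o, (o < blen)%N -> x (cell o) = y (cell o)) -> marked x = marked y.
Proof.
move=> xy; rewrite /marked; congr [&& _, _, _ & _].
- by rewrite -cell0 xy // /blen; lia.
- by rewrite xy // /blen; lia.
- by apply: eq_forallb => i; rewrite xy // /blen; have := ltn_ord i; lia.
- by apply: eq_forallb => j; rewrite xy // off_lt.
Qed.

Lemma marked_zero x o : marked x -> ~~ odd o -> (2 <= o < blen)%N -> x (cell o) = a0.
Proof.
move=> /and4P[_ _ /forallP xz _] eo /andP[o2 oK].
have io : (o./2.-1 < #|T|.+1)%N by move: oK; rewrite /blen; lia.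
have /eqP := xz (Ordinal io); rewrite /= (_ : (2 * o./2.-1 + 2 = o)%N) //; lia.
Qed.

(** One of the offsets [i], [i + 1] is even, at least 2 and inside the first word, which has [a0]
    there, while the second word starts with [a1 a1]. *)
Lemma marked_sep x (i : nat) : marked x -> marked (view x (cell i)) ->
  (0 < i < blen)%N -> False.
Proof.
move=> mx /and4P[/eqP x0 /eqP x1 _ _] /andP[i0 iK].
move: x0 x1; rewrite /view addr0 -mulrnDr => x0 x1.
have [oi|ei] := boolP (odd i).
  move: x1; rewrite marked_zero //; first by move/eqP; rewrite (negPf a01).
    by rewrite addn1 /= oi.
  by move: iK oi; rewrite /blen; lia.
move: x0; rewrite marked_zero //; first by move/eqP; rewrite (negPf a01).
by move: i0 ei; case: (i) iK => [|[|]].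
Qed.

Lemma marked_inj x p q o o' : marked (view x p) -> marked (view x q) ->
  p + cell o = q + cell o' -> (o < blen)%N -> (o' < blen)%N -> p = q.
Proof.
wlog oo' : p q o o' / (o' <= o)%N.
  move=> W mp mq pq oK o'K; have [?|/ltnW ?] := leqP o' o; first exact: (W p q o o').
  by apply/esym; exact: (W q p o' o).
move=> mp mq pq oK o'K.
have qp : q = p + cell (o - o').
  by apply: (addIr (cell o')); rewrite -pq -addrA -mulrnDr subnK.
move: oo'; rewrite leq_eqVlt => /orP[/eqP oo'|oo'].
  by rewrite qp oo' subnn addr0.
exfalso; apply: (@marked_sep (view x p) (o - o')) => //.
  by rewrite view_view -qp.
by lia.
Qed.

Lemma flip_other j S x p o : marked (view x p) -> (o < blen)%N -> o != off j ->
  flip j S x (p + cell o) = x (p + cell o).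
Proof.
move=> mp oK /eqP oj; rewrite /flip; set q := _ - _.
case: ifP => // /andP[mq _]; case: oj; apply: cell_inj; apply: (addrI p).
have pq : p = q by apply: (marked_inj mp mq _ oK (off_lt j)); rewrite subrK.
by rewrite {2}pq subrK.
Qed.

Lemma flip_self j S x p : flip j S x (p + cell (off j)) =
  if marked (view x p) && S p then sw (x (p + cell (off j))) else x (p + cell (off j)).
Proof. by rewrite /flip addrK. Qed.

Lemma marked_flip_sub j S x p : marked (view x p) -> marked (view (flip j S x) p).
Proof.
move=> mp; have := mp; rewrite /marked => /and4P[x0 x1 xz xd].
have o2 : off j != 0%N by rewrite /off; lia.
apply/and4P; split.
- by rewrite /view -cell0 flip_other //; rewrite /blen /off; lia.
- by rewrite /view flip_other //; rewrite /blen /off; lia.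
- apply/forallP => i; rewrite /view flip_other //; first exact: (forallP xz i).
    by have := ltn_ord i; rewrite /blen; lia.
  by rewrite /off; lia.
- apply/forallP => i; have xi := forallP xd i.
  have [->|ij] := eqVneq i j; last first.
    by rewrite /view flip_other // ?off_lt //; apply: contraNneq ij => /off_inj->.
  rewrite /view flip_self; case: ifP => _; last exact: (forallP xd j).
  have := forallP xd j; rewrite /view /sw !inE.
  by case: eqP => [_|_]; rewrite ?eqxx ?orbT //= => ->; rewrite eqxx.
Qed.

Lemma marked_flip j S x p : marked (view (flip j S x) p) = marked (view x p).
Proof.
apply/idP/idP; last exact: marked_flip_sub.
move=> mp; apply: contraT => nmp; rewrite -(negPf nmp).
suff -> : marked (view x p) = marked (view (flip j S x) p) by [].
(* A cell of the word at [p] altered by the flip lies in a word marked before and after it.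
   Overlapping words coincide, so [p] would have been marked already. *)
apply/esym/marked_ext => o oK; rewrite /view /flip; set q := _ - _.
case: ifP => // /andP[mq _]; case/negP: nmp.
have -> // : p = q.
apply: (marked_inj mp (marked_flip_sub j S mq) _ oK (off_lt j)); by rewrite subrK.
Qed.

Lemma bit_flip i j S x p : bit i (view (flip j S x) p) =
  bit i (view x p) (+) [&& i == j, marked (view x p) & S p].
Proof.
rewrite /bit marked_flip; case mp: (marked (view x p)); last by rewrite andbF.
rewrite /= {1}/view; have [->|ij] /= := eqVneq i j; last first.
  rewrite flip_other ?off_lt ?addbF //.
  by apply: contraNneq ij => /off_inj->.
rewrite flip_self mp /=; case: (S p); last by rewrite addbF.
have := mp; rewrite /marked => /and4P[_ _ _ /forallP/(_ j)].
rewrite /view /sw !inE => /orP[|] /eqP->; rewrite !eqxx ?(negPf a01) //.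
by rewrite ![a1 == a0]eq_sym (negPf a01) (negPf a01).
Qed.

Lemma flipC i j S S' x : flip i S (flip j S' x) = flip j S' (flip i S x).
Proof.
apply/funext => q; rewrite /flip -/(flip j S' x) -/(flip i S x) !marked_flip.
by case: ifP; case: ifP.
Qed.

Lemma flipD j S S' x : flip j S (flip j S' x) = flip j (fun p => S p (+) S' p) x.
Proof.
apply/funext => q; rewrite {1}/flip marked_flip /flip.
by case: (marked _) => //=; case: (S _) (S' _) => -[] //=; rewrite swK.
Qed.

Lemma flip_ext j S S' x :
  (forall p, marked (view x p) -> S p = S' p) -> flip j S x = flip j S' x.
Proof.
move=> SS'; apply/funext => q; rewrite /flip.
by case mq : (marked _) => //=; rewrite SS'.
Qed.

Lemma flip0 j x : flip j xpred0 x = x.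
Proof. by apply/funext => q; rewrite /flip andbF. Qed.

Lemma view_flip j S x p : view (flip j S x) p = flip j (fun q => S (p + q)) (view x p).
Proof. by apply/funext => q; rewrite {1}/view /flip view_view addrA. Qed.

Definition blind j phi := forall S x, phi (flip j S x) = phi x.

Definition toggle j phi x := flip j (fun p => phi (view x p)) x.

Lemma view_toggle j phi x p : view (toggle j phi x) p = toggle j phi (view x p).
Proof.
by rewrite /toggle view_flip; apply: flip_ext => q _; rewrite view_view.
Qed.

Lemma marked_toggle j phi x p : marked (view (toggle j phi x) p) = marked (view x p).
Proof. exact: marked_flip. Qed.

Lemma bit_toggle i j phi x p : bit i (view (toggle j phi x) p) =
  bit i (view x p) (+) [&& i == j, marked (view x p) & phi (view x p)].
Proof. exact: bit_flip. Qed.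

(** Since [phi] ignores track [j], the inner toggle does not change its value, and the controls add
    in F_2. *)
Lemma toggleD j phi psi x : blind j phi ->
  toggle j phi (toggle j psi x) = toggle j (fun y => phi y (+) psi y) x.
Proof.
move=> ji; rewrite /toggle -flipD; apply: flip_ext => p _.
by rewrite view_flip ji.
Qed.

Lemma toggle_ext j phi psi x : (forall y, marked y -> phi y = psi y) ->
  toggle j phi x = toggle j psi x.
Proof. by move=> pp; apply: flip_ext => p /pp. Qed.

Lemma toggleK j phi : blind j phi -> involutive (toggle j phi).
Proof.
move=> ji x; rewrite toggleD // -[RHS](flip0 j); apply: flip_ext => p _.
by rewrite addbb.
Qed.

Definition finitary phi := exists w, forall x y, agree_on w x y -> phi x = phi y.

Lemma agree_on_view w x y p : agree_on [seq p + h | h <- w] x y ->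
  agree_on w (view x p) (view y p).
Proof. by move=> xy h hw; apply: xy; exact: map_f. Qed.

Lemma finitary_view phi p : finitary phi -> finitary (fun x => phi (view x p)).
Proof.
move=> [w wP]; exists [seq p + h | h <- w] => x y /agree_on_view; exact: wP.
Qed.

Lemma finitary2 (op : bool -> bool -> bool) phi psi :
  finitary phi -> finitary psi -> finitary (fun x => op (phi x) (psi x)).
Proof.
move=> [w wP] [w' w'P]; exists (w ++ w') => x y /agree_on_cat[xy x'y].
by rewrite (wP x y) // (w'P x y).
Qed.

Lemma finitary_cst b : finitary (fun=> b).
Proof. by exists [::]. Qed.

Lemma finitary_marked : finitary marked.
Proof.
exists [seq cell o | o <- iota 0 blen] => x y xy; apply: marked_ext => o oK.
by apply: xy; apply: map_f; rewrite mem_iota.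
Qed.

Lemma finitary_bit j : finitary (bit j).
Proof.
apply: (@finitary2 andb) finitary_marked _; exists [:: cell (off j)] => x y xy.
by rewrite xy ?mem_head.
Qed.

Lemma finitary_forall (I : finType) (phi : I -> X -> bool) :
  (forall i, finitary (phi i)) -> finitary (fun x => [forall i, phi i x]).
Proof.
move=> lp; have [w wP] : exists w, forall x y, agree_on w x y ->
    forall i, i \in enum I -> phi i x = phi i y.
  elim: (enum I) => [|i s [w wP]]; first by exists [::].
  have [w' w'P] := lp i; exists (w' ++ w) => x y /agree_on_cat[x'y xy] k.
  by rewrite inE => /orP[/eqP->|/(wP _ _ xy)//]; exact: w'P.
exists w => x y xy; apply: eq_forallb => i; by apply: wP; rewrite ?mem_enum.
Qed.

Lemma toggle_is_rca j phi : blind j phi -> finitary phi ->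
  `[< equivariant (toggle j phi) /\ homeomorphism (toggle j phi) >].
Proof.
move=> ij lp; apply/asboolP.
have ct : continuous (toggle j phi).
  apply: window_continuous => q; rewrite /toggle /flip.
  have [w wP] := finitary_view (q - cell (off j)) (@finitary2 andb _ _ finitary_marked lp).
  exists (q :: w) => x y xy; rewrite (wP x y) => [|h hw]; last first.
    by apply: xy; rewrite inE hw orbT.
  by rewrite xy ?mem_head.
split; last by exists (toggle j phi); split=> //; exact: toggleK.
by move=> g x; rewrite -[g]opprK -!view_shift view_toggle.
Qed.

(* Falls back to the identity when [toggle j phi] is not an automorphism. *)
Definition gate j phi : RCA A G := insubd (1%g : RCA A G) (toggle j phi).

Lemma gateE j phi x : blind j phi -> finitary phi -> gate j phi x = toggle j phi x.
Proof.
by move=> ij lp; have -> := insubdK (1%g : RCA A G) (toggle_is_rca ij lp).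
Qed.

End Coding.

(** * Powers of a 2 x 2 matrix in characteristic 2 *)

Section Char2Power.
Variables (V : zmodType) (a : V -> V).
Hypothesis V2 : forall v : V, v + v = 0.
Hypothesis aD : {morph a : u v / u + v}.

(** The matrix with rows [(1, a)] and [(1, a + 1)], of trace [a] and determinant 1 in characteristic
    2. It factors into two elementary additions, each realizable by one gate. *)
Definition line_step (p : V * V) : V * V := (p.1 + a p.2, p.1 + a p.2 + p.2).

Let ap (c : V -> V) (p : V * V) : V * V := (c p.1, c p.2).

Lemma line_stepD p q : line_step (p + q) = line_step p + line_step q.
Proof.
case: p q => [u v] [u' v']; rewrite /line_step /= aD; congr (_, _) => /=.
  by rewrite addrACA.
by rewrite (addrACA u) [LHS]addrACA.
Qed.

Lemma line_step_sqr p : line_step (line_step p) = ap a (line_step p) + p.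
Proof.
case: p => u v; rewrite /line_step /ap /= !aD; congr (_, _) => /=.
  by rewrite addrC -addrA [a v + _]addrCA V2 addr0.
by rewrite addrACA V2 add0r.
Qed.

(* Over characteristic 2 the step [h] satisfies [h^2 = a h + 1], so repeated
   squaring gives [h^(2^m) = a^(2^m-1) h + c] with [c] a polynomial in [a]. *)
Lemma line_step_pow m : exists c : V -> V,
  [/\ {morph c : u v / u + v}, forall v, c (a v) = a (c v) & forall p,
    iter (2 ^ m) line_step p = ap (iter (2 ^ m).-1 a) (line_step p) + ap c p].
Proof.
have aiterD n : {morph iter n a : u v / u + v}.
  by elim: n => // n IH u v; rewrite !iterS IH aD.
have aiterC n v : iter n a (a v) = a (iter n a v) by rewrite -iterSr.
have stepC c p : {morph c : u v / u + v} -> (forall v, c (a v) = a (c v)) ->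
    line_step (ap c p) = ap c (line_step p).
  by case: p => u v cD ca; rewrite /line_step /ap /= !cD !ca.
have apD c p q : {morph c : u v / u + v} -> ap c (p + q) = ap c p + ap c q.
  by move=> cD; rewrite /ap /= !cD.
elim: m => [|m [c [cD ca cP]]].
  exists (fun=> 0); split=> [u v|v|p]; rewrite ?addr0 //.
  have := aD 0 0; rewrite addr0 => a0; apply: (addrI (a 0)).
  by rewrite addr0 -a0.
set n := (2 ^ m).-1 in cP.
(* Squaring [a^n h + c] kills the cross terms and leaves [a^(2n) (a h + 1) + c^2], so the new [c] is
   [a^(2n) + c^2]. *)
exists (fun v => iter n a (iter n a v) + c (c v)); split.
- by move=> u v; rewrite !(aiterD, cD) addrACA.
- by move=> v; rewrite aD !(aiterC, ca).
move=> p; rewrite expnS mul2n -addnn iterD !cP.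
rewrite line_stepD !stepC //.
rewrite line_step_sqr !apD // addrACA.
have -> : (2 ^ m + 2 ^ m).-1 = (n + n).+1 by have := expn_gt0 2 m; rewrite /n; lia.
have cA q : ap c (ap (iter n a) q) = ap (iter n a) (ap c q).
  have cI k v : c (iter k a v) = iter k a (c v).
    by elim: k => // k IH; rewrite !iterS ca IH.
  by rewrite /ap /= !cI.
have cancel2 (u1 u2 u3 w : V) : u1 + u2 + u3 + (u3 + w) = u1 + (u2 + w).
  by rewrite addrA -(addrA _ u3 u3) V2 addr0 addrA.
rewrite cA; have -> (u1 u2 u3 w : V * V) : u1 + u2 + u3 + (u3 + w) = u1 + (u2 + w).
  by congr (_, _); exact: cancel2.
congr (_ + _); by rewrite /ap /= !iterD !aiterC.
Qed.

Lemma iter_line_stepD n p q :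
  iter n line_step (p + q) = iter n line_step p + iter n line_step q.
Proof. by elim: n => // n IH; rewrite !iterS IH line_stepD. Qed.

(** One step sends [(s, 0)] to [(s, s)], and the [c] part adds nothing to the second entry: only a
    pure power of [a] remains. *)
Lemma line_step_seed m s :
  (iter (2 ^ m) line_step (s, 0)).2 = iter (2 ^ m).-1 a s.
Proof.
have [c [cD _ ->]] := line_step_pow m.
have zero (f : V -> V) : {morph f : u v / u + v} -> f 0 = 0.
  by move=> fD; apply: (addrI (f 0)); rewrite -fD !addr0.
by rewrite /ap /= (zero c) // (zero a) // !addr0.
Qed.

End Char2Power.

(** * Calculus of word lengths of controlled toggles *)

Section Realizable.
Variables (A : finType) (a0 a1 : A) (D : nat) (T : finType).
Hypothesis a01 : a0 != a1.
Local Notation G := 'rV[int]_D.+1.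
Local Notation X := (config A G).
Local Notation marked := (@marked A a0 a1 D T).
Local Notation bit := (@bit A a0 a1 D T).
Local Notation flip := (@flip A a0 a1 D T).
Local Notation toggle := (@toggle A a0 a1 D T).
Local Notation blind := (@blind A a0 a1 D T).
Local Notation gate := (@gate A a0 a1 D T).
Implicit Types (x y : X) (p q : G) (i j t c : T) (phi psi chi : X -> bool).
Implicit Types (g h : RCA A G).

Lemma rcaK g : cancel g (g^-1)%g.
Proof. by move=> x; rewrite -rcaM mulVg. Qed.

Lemma rcaKV g : cancel (g^-1)%g g.
Proof. by move=> x; rewrite -rcaM mulgV. Qed.

Lemma view_rca g x p : view (g x) p = g (view x p).
Proof. by rewrite !view_shift (rca_equivariant g). Qed.

Lemma blind_marked i : blind i marked.
Proof. by move=> S x; rewrite -(view0 (flip _ _ _)) marked_flip // view0. Qed.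

Lemma blind_bit i c : i != c -> blind i (bit c).
Proof.
move=> ic S x; rewrite -(view0 (flip _ _ _)) bit_flip // view0 eq_sym (negPf ic).
by rewrite addbF.
Qed.

Lemma blind_view i phi p : blind i phi -> blind i (fun x => phi (view x p)).
Proof. by move=> ip S x; rewrite /= view_flip ip. Qed.

Lemma blind2 (op : bool -> bool -> bool) i phi psi :
  blind i phi -> blind i psi -> blind i (fun x => op (phi x) (psi x)).
Proof. by move=> ip iq S x; rewrite ip iq. Qed.

(** Such a map does not use the content of track [i] as a control; adding to track [i] is still
    allowed. *)
Definition neutral i (w : X -> X) := forall S x, w (flip i S x) = flip i S (w x).

Lemma blind_neutral i w phi : neutral i w -> blind i phi -> blind i (phi \o w).
Proof. by move=> iw ip S x; rewrite /= iw ip. Qed.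

Lemma neutral_toggle i j phi : blind i phi -> neutral i (toggle j phi).
Proof.
move=> ip S x; rewrite /toggle flipC //; congr (flip i S _); congr (flip j _ x).
by apply/funext => p; rewrite view_flip // ip.
Qed.

Lemma neutralM i g h : neutral i g -> neutral i h -> neutral i (g * h)%g.
Proof. by move=> ig ih S x; rewrite !rcaM ih ig. Qed.

Lemma neutralV i g : neutral i g -> neutral i (g^-1)%g.
Proof.
by move=> ig S x; rewrite -{1}(rcaKV g x) -ig rcaK.
Qed.

Lemma neutralX i g n : neutral i g -> neutral i (g ^+ n)%g.
Proof. by move=> ig; elim: n => // n IH; rewrite expgS; exact: neutralM. Qed.

Variable gens : seq (RCA A G).
Hypothesis gensK : forall g, g \in gens -> (g * g = 1)%g.

Definition cost j phi n := exists g, word gens n g /\ g =1 toggle j phi.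

Lemma cost_ext j phi psi n : (forall y, marked y -> phi y = psi y) ->
  cost j phi n -> cost j psi n.
Proof.
move=> pp [g [gn gE]]; exists g; split=> // x; rewrite gE; exact: toggle_ext.
Qed.

Lemma cost_leq j phi m n : (m <= n)%N -> cost j phi m -> cost j phi n.
Proof. by move=> mn [g [gm gE]]; exists g; split=> //; exact: wordS mn gm. Qed.

Lemma cost_gen j phi : blind j phi -> finitary phi -> gate j phi \in gens ->
  cost j phi 1.
Proof.
by move=> ip lp jg; exists (gate j phi); split; [exact: word_gen|move=> x; exact: gateE].
Qed.

(** Conjugating by [g] evaluates the control after [g]. The inverse is as short as [g] because the
    generators are involutions. *)
Lemma cost_conj j phi g m n : neutral j g -> word gens m g ->
  cost j phi n -> cost j (phi \o g) (m + n + m).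
Proof.
move=> ig gm [h [hn hE]]; exists (g^-1 * h * g)%g; split.
  by apply: wordM (gm); apply: wordM hn; apply: wordV gm.
move=> x; rewrite !rcaM hE; apply: (canLR (rcaK g)).
rewrite /toggle ig; apply: flip_ext => p _.
by rewrite view_rca.
Qed.

Lemma cost_add j phi psi m n : blind j phi -> cost j phi m -> cost j psi n ->
  cost j (fun x => phi x (+) psi x) (m + n).
Proof.
move=> ip [g [gm gE]] [h [hn hE]]; exists (g * h)%g; split; first exact: wordM.
by move=> x; rewrite rcaM gE hE toggleD.
Qed.

(** This is the commutator of the toggle with [g]: only the change that [g] makes to [phi] is
    written. *)
Lemma cost_comm j phi g m n : blind j phi -> neutral j g -> word gens m g ->
  cost j phi n -> cost j (fun x => phi x (+) phi (g x)) (2 * (m + n)).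
Proof.
move=> ip ig gm pn; apply: (cost_leq _ (cost_add ip pn (cost_conj ig gm pn))).
by lia.
Qed.

(* Commutator of controlled toggles: controls [psi, bit c] and [chi] multiply,
   whatever the content of the borrowed track [c]. *)
Lemma cost_and t c psi chi p m n : t != c -> blind t psi -> blind c psi ->
  blind t chi -> blind c chi ->
  cost t (fun x => psi x && bit c (view x p)) n -> cost c chi m ->
  cost t (fun x => psi x && (marked (view x p) && chi (view x p))) (2 * (m + n)).
Proof.
move=> tc tpsi cpsi tchi cchi pn [g [gm gE]].
have ng : neutral t g by move=> S x; rewrite !gE; exact: neutral_toggle.
apply: cost_ext (cost_comm _ ng gm pn) => [x _|]; last first.
  by apply: (@blind2 andb) => //; apply: blind_view; exact: blind_bit.
rewrite gE /toggle cpsi bit_flip // eqxx /=.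
by case: (psi x) => //=; rewrite addbA addbb.
Qed.

End Realizable.

(** * Checking a line in linear word length *)

Section Lines.
Variables (A : finType) (a0 a1 : A) (D : nat) (T : finType).
Hypothesis a01 : a0 != a1.
Local Notation G := 'rV[int]_D.+1.
Local Notation X := (config A G).
Local Notation marked := (@marked A a0 a1 D T).
Local Notation bit := (@bit A a0 a1 D T).
Local Notation flip := (@flip A a0 a1 D T).
Local Notation toggle := (@toggle A a0 a1 D T).
Local Notation blind := (@blind A a0 a1 D T).
Local Notation neutral := (@neutral A a0 a1 D T).
Local Notation gate := (@gate A a0 a1 D T).
Variable gens : seq (RCA A G).
Hypothesis gensK : forall g, g \in gens -> (g * g = 1)%g.
Local Notation cost := (@cost A a0 a1 D T gens).

(** The last cell contributes only its mark: this is the [n]-th iterate of multiplication by marks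
    and [z] along [e], applied to the seed of all marked cells. *)
Fixpoint line (z : X -> bool) (e : G) n x :=
  if n is n'.+1 then [&& marked x, z x & line z e n' (view x e)] else marked x.

Lemma blind_line i z e n : blind i z -> blind i (line z e n).
Proof.
move=> iz; elim: n => [|n IH] /=; first exact: blind_marked.
by move=> S x; rewrite blind_marked // iz (blind_view _ IH).
Qed.

Variables (c0 c1 c2 : T) (z : X -> bool) (e : G).
Hypotheses (c01 : c0 != c1) (c02 : c0 != c2) (c12 : c1 != c2).
Hypotheses (z0 : blind c0 z) (z1 : blind c1 z) (z2 : blind c2 z) (lz : finitary z).
Let E := gate c1 (fun x => z x && bit c2 (view x e)).
Let F := gate c2 (bit c1).
Let I := gate c1 (fun=> true).
Hypotheses (Eg : E \in gens) (Fg : F \in gens) (Ig : I \in gens).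
Hypothesis Og : gate c0 (bit c2) \in gens.

Let track c (x : X) : G -> bool := fun p => bit c (view x p).
Let zeta (x : X) : G -> bool := fun p => marked (view x p) && z (view x p).
Let along (s : G -> bool) (b : G -> bool) : G -> bool := fun p => s p && b (p + e).

Lemma blind_E i : i != c2 -> blind i z ->
  blind i (fun x => z x && bit c2 (view x e)).
Proof.
move=> ic iz; apply: (@blind2 _ _ _ _ _ andb) => //.
by apply: (blind_view (phi := bit c2)); exact: blind_bit.
Qed.

Lemma EE x : E x = toggle c1 (fun x => z x && bit c2 (view x e)) x.
Proof.
apply: gateE => //; first exact: blind_E.
by apply: (@finitary2 _ _ andb) => //; apply: finitary_view; exact: finitary_bit.
Qed.

Lemma FE x : F x = toggle c2 (bit c1) x.
Proof. by apply: gateE => //; [apply: blind_bit => //; rewrite eq_sym|exact: finitary_bit]. Qed.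

Lemma IE x : I x = toggle c1 (fun=> true) x.
Proof. by apply: gateE => //; exact: finitary_cst. Qed.

Lemma marked_bit c x : marked x && bit c x = bit c x.
Proof. by rewrite /bit; case: (marked x). Qed.

Let h := (F * E)%g.

Lemma hE x : h x = F (E x).
Proof. by []. Qed.

Lemma marked_h x p : marked (view (h x) p) = marked (view x p).
Proof. by rewrite hE FE EE !marked_toggle. Qed.

Lemma marked_hX n x p : marked (view ((h ^+ n)%g x) p) = marked (view x p).
Proof. by elim: n => // n IH; rewrite expgS rcaM marked_h. Qed.

Lemma z_toggle c phi x p : blind c z -> z (view (toggle c phi x) p) = z (view x p).
Proof. by move=> zc; rewrite view_toggle // zc. Qed.

Lemma zeta_h x : zeta (h x) = zeta x.
Proof.
by apply/funext => p; rewrite /zeta marked_h hE FE EE !z_toggle.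
Qed.

(** [E] adds track [c2], shifted and masked by [zeta], to [c1]; then [F] adds [c1] to [c2]. *)
Lemma track_h x : (track c1 (h x), track c2 (h x)) =
  line_step (along (zeta x)) (track c1 x, track c2 x).
Proof.
have Ex p : bit c1 (view (E x) p) = bit c1 (view x p) (+) (along (zeta x) (track c2 x) p).
  rewrite EE bit_toggle // eqxx /along /zeta /track view_view.
  by case: (marked _); case: (z _).
rewrite hE /line_step; congr (_, _); apply/funext => p; rewrite /track FE bit_toggle //.
  by rewrite (negPf c12) /= addbF Ex.
rewrite eqxx /= marked_bit Ex addbC; congr (_ (+) _).
by rewrite EE bit_toggle // eq_sym (negPf c12) addbF.
Qed.

Lemma track_hX n x : (track c1 ((h ^+ n)%g x), track c2 ((h ^+ n)%g x)) =
  iter n (line_step (along (zeta x))) (track c1 x, track c2 x)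
  /\ zeta ((h ^+ n)%g x) = zeta x.
Proof.
elim: n => [//|n [IH zn]]; rewrite expgS iterS !rcaM -/h zeta_h zn; split=> //.
by rewrite track_h zn IH.
Qed.

Lemma cost_line m : cost c0 (line z e (2 ^ m).-1) (12 * 2 ^ m).
Proof.
(* [W] undoes [M], adds 1 to track [c1] and redoes [M]. By linearity tracks [c1], [c2] change by the
   [2 ^ m]-th line step of [(seed, 0)], whose second entry is the line. A commutator with the copy
   of [c2] into [c0] writes this change, whatever the tracks held. *)
set M := (h ^+ (2 ^ m))%g; pose W := (M * I * M^-1)%g.
have Mw : word gens (2 * 2 ^ m) M.
  by apply: wordX; apply: (@wordM _ _ 1 1); exact: word_gen.
have Ww : word gens (2 * 2 ^ m + 1 + 2 * 2 ^ m) W.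
  apply: wordM; last exact: wordV.
  by apply: wordM => //; exact: word_gen.
have nM : neutral c0 M.
  apply: neutralX; apply: neutralM => S x; rewrite ?EE ?FE.
    by apply: neutral_toggle => //; exact: blind_bit.
  by apply: neutral_toggle => //; exact: blind_E.
have nW : neutral c0 W.
  apply: neutralM; last exact: neutralV.
  apply: neutralM => // S x; rewrite !IE; exact: neutral_toggle.
have oO : blind c0 (bit c2) by exact: blind_bit.
have costO : cost c0 (bit c2) 1 by apply: cost_gen => //; exact: finitary_bit.
apply: cost_leq (cost_ext _ (cost_comm a01 gensK oO nW Ww costO)) => [|x _].
  by have := expn_gt0 2 m; lia.
pose y := (M^-1)%g x.
have yx : M y = x by exact: rcaKV.
have [xy zy] := track_hX (2 ^ m) y; rewrite -/M yx in xy zy.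
have [Iy _] := track_hX (2 ^ m) (I y); rewrite -/M in Iy.
have zI : zeta (I y) = zeta y.
  by apply/funext => p; rewrite /zeta IE marked_toggle // z_toggle.
have tI : (track c1 (I y), track c2 (I y)) =
    (track c1 y, track c2 y) + ((fun p => marked (view x p)), 0).
  congr (_, _); apply/funext => p; rewrite /track IE bit_toggle //=.
    by rewrite eqxx andbT -(marked_hX (2 ^ m) y) -/M yx.
  by rewrite eq_sym (negPf c12) addr0 addbF.
have alongD : {morph along (zeta y) : s t / s + t}.
  move=> s t; apply/funext => p; rewrite /along /=.
  by rewrite -[LHS]/(_ && (_ (+) _)) andb_addr.
have bb (s : G -> bool) : s + s = 0 by apply/funext => p; exact: addbb.
have lineE n p : iter n (along (zeta y)) (fun p => marked (view x p)) p = line z e n (view x p).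
  elim: n p => // n IH p; rewrite iterS /along IH /= -zy /zeta view_view.
  by rewrite andbA.
move: Iy; rewrite zI tI iter_line_stepD // -xy => /(congr1 snd) /=.
rewrite line_step_seed // => /(congr1 (fun s => s 0)) WE.
have -> : bit c2 (W x) = track c2 (M (I y)) 0 by rewrite /track view0.
rewrite WE -[(_ + _) 0]/(_ (+) _) lineE /track view0 addbA addbb.
by [].
Qed.

End Lines.

(** * Tracks, local rules and the finite generating set *)

Section Boxes.
Variables (A : finType) (a0 a1 : A) (D : nat).
Hypothesis a01 : a0 != a1.
(* Four work tracks, one ancilla track and one face track per direction. *)
Definition tracks : finType := ('I_4 + 'I_D.+1 + 'I_D.+1)%type.
Local Notation T := tracks.
Local Notation G := 'rV[int]_D.+1.
Local Notation X := (config A G).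
Local Notation marked := (@marked A a0 a1 D T).
Local Notation bit := (@bit A a0 a1 D T).
Local Notation flip := (@flip A a0 a1 D T).
Local Notation toggle := (@toggle A a0 a1 D T).
Local Notation blind := (@blind A a0 a1 D T).
Local Notation neutral := (@neutral A a0 a1 D T).
Local Notation gate := (@gate A a0 a1 D T).
Local Notation line := (@line A a0 a1 D T).
Implicit Types (x y : X) (j : T) (phi psi : X -> bool).

Definition work (i : 'I_4) : T := inl (inl i).
Definition anc (k : 'I_D.+1) : T := inl (inr k).
Definition face (k : 'I_D.+1) : T := inr k.

Local Notation c0 := (work (@Ordinal 4 0 isT)).
Local Notation c1 := (work (@Ordinal 4 1 isT)).
Local Notation c2 := (work (@Ordinal 4 2 isT)).
Local Notation u := (work (@Ordinal 4 3 isT)).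

(** A stride of [blen] cells lets words at consecutive lattice points abut along the first axis
    without overlap. *)
Definition step (k : 'I_D.+1) : G := delta_mx 0 k *+ blen T.
Definition sstep (b : bool) k : G := if b then step k else - step k.

(* If [face_rule] holds throughout a box and [corner] at its corner, then inside
   the box [face i] holds exactly on the facet where the i-th coordinate is 0. *)
Definition face_rule x := marked x && [forall i, ~~ bit (face i) (view x (step i)) &&
  [forall k, (k == i) || (bit (face i) (view x (step k)) == bit (face i) x)]].

Definition corner x := [forall i, bit (face i) x].

(** On a marked cell, [b = true] tests for an ancilla 0 and [b = false] for an ancilla 1. *)
Definition anc_bit (b : bool) k x := bit (anc k) x (+) b.

(** In order: copies of [c0] to other tracks; the product gate; the gates shared by all lines; local
    checks and the reading of [u]; the masked line gates; moves by one step. None depends on the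
    side of the box. *)
Definition gens : seq (RCA A G) :=
  [seq gate j (bit c0) | j <- enum {: T} & j != c0] ++
  [:: gate c0 (fun x => bit c2 x && bit c1 x); gate c2 (bit c1); gate c1 (fun=> true);
      gate c0 (bit c2); gate c0 face_rule; gate c0 corner; gate c0 (bit u)] ++
  [seq gate c1 (fun x => anc_bit b k x && bit c2 (view x (step k)))
     | b <- enum {: bool}, k <- enum 'I_D.+1] ++
  [seq gate c0 (fun x => bit c1 (view x (sstep b k)))
     | b <- enum {: bool}, k <- enum 'I_D.+1].

Lemma gate_sqr j phi : blind j phi -> finitary phi -> (gate j phi * gate j phi = 1)%g.
Proof.
move=> ip lp; apply/val_inj/funext => x /=.
by rewrite !gateE // toggleK.
Qed.

Lemma blind_forall (I : finType) i (phi : I -> X -> bool) :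
  (forall k, blind i (phi k)) -> blind i (fun x => [forall k, phi k x]).
Proof. by move=> ip S x; apply: eq_forallb => k; exact: ip. Qed.

Lemma blind_true i : blind i (fun=> true).
Proof. by []. Qed.

Lemma blind_anc_bit i b k : i != anc k -> blind i (anc_bit b k).
Proof. by move=> ik S x; rewrite /anc_bit (blind_bit a01 ik). Qed.

Lemma finitary_anc_bit b k : finitary (anc_bit b k).
Proof. by apply: (@finitary2 _ _ addb); [exact: finitary_bit|exact: finitary_cst]. Qed.

Lemma blind_face_rule (v : 'I_4 + 'I_D.+1) : blind (inl v) face_rule.
Proof.
apply: (@blind2 _ _ _ _ _ andb); first exact: blind_marked.
apply: blind_forall => i; have ib : blind (inl v) (bit (face i)) by exact: blind_bit.
apply: (@blind2 _ _ _ _ _ andb) => [S x|].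
  by congr negb; exact: (blind_view (phi := bit (face i))).
apply: blind_forall => k S x; rewrite ib; congr (_ || (_ == _)).
exact: (blind_view (phi := bit (face i))).
Qed.

Lemma finitary_face_rule : finitary face_rule.
Proof.
apply: (@finitary2 _ _ andb); first exact: finitary_marked.
apply: finitary_forall => i; apply: (@finitary2 _ _ (fun a b => ~~ a && b)).
  by apply: finitary_view; exact: finitary_bit.
apply: finitary_forall => k; apply: (@finitary2 _ _ orb); first exact: finitary_cst.
by apply: (@finitary2 _ _ (fun a b => a == b)); [apply: finitary_view|]; exact: finitary_bit.
Qed.

Lemma blind_corner (v : 'I_4 + 'I_D.+1) : blind (inl v) corner.
Proof. by apply: blind_forall => i; exact: blind_bit. Qed.

Lemma finitary_corner : finitary corner.
Proof. by apply: finitary_forall => i; exact: finitary_bit. Qed.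

Lemma blind_view_bit i j p : i != j -> blind i (fun x => bit j (view x p)).
Proof. by move=> ij; apply: (blind_view (phi := bit j)); exact: blind_bit. Qed.

Lemma finitary_view_bit j p : finitary (fun x => bit j (view x p)).
Proof. by apply: finitary_view; exact: finitary_bit. Qed.

Lemma gensK g : g \in gens -> (g * g = 1)%g.
Proof.
rewrite !mem_cat => /or4P[/mapP[j]|||].
- rewrite mem_filter => /andP[j0 _] ->; apply: gate_sqr; last exact: finitary_bit.
  exact: blind_bit.
- rewrite !inE => /or4P[|||/or4P[]] /eqP->; apply: gate_sqr;
    try exact: finitary_bit; try exact: blind_bit; try exact: finitary_cst;
    try exact: finitary_face_rule; try exact: finitary_corner; try exact: blind_face_rule;
    try exact: blind_corner; try by [].
  + by apply: (@blind2 _ _ _ _ _ andb); exact: blind_bit.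
  + by apply: (@finitary2 _ _ andb); exact: finitary_bit.
- move=> /allpairsP[[b k] [_ _ ->]] /=; apply: gate_sqr.
    by apply: (@blind2 _ _ _ _ _ andb); [exact: blind_anc_bit|exact: blind_view_bit].
  by apply: (@finitary2 _ _ andb); [exact: finitary_anc_bit|exact: finitary_view_bit].
- move=> /allpairsP[[b k] [_ _ ->]] /=; apply: gate_sqr; last exact: finitary_view_bit.
  exact: blind_view_bit.
Qed.

(** * Word length of a box check *)

Local Notation cost := (@cost A a0 a1 D T gens).

(** A case of [cost_and] with trivial first control, where [c0] is the borrowed track. *)
Lemma cost_transfer t phi n : t != c0 -> blind c0 phi -> blind t phi ->
  cost c0 phi n -> cost t phi (2 * n.+1).
Proof.
move=> t0 ip0 ipt pn.
have gt : cost t (fun x => true && bit c0 (view x 0)) 1.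
  have : cost t (bit c0) 1.
    apply: cost_gen => //; [exact: blind_bit|exact: finitary_bit|].
    by rewrite mem_cat; apply/orP; left; apply: map_f; rewrite mem_filter t0 mem_enum.
  by apply: cost_ext => x _; rewrite view0.
have := cost_and a01 gensK t0 (blind_true _) (blind_true _) ipt ip0 gt pn.
by rewrite addn1; apply: cost_ext => x mx; rewrite view0 mx.
Qed.

(** Starting from the gate that adds [c2 c1] to [c0], [cost_and] replaces [c1] by [phi] and then
    [c2] by [psi]. *)
Lemma cost_prod phi psi m n :
  (forall i : 'I_4, (i < 3)%N -> blind (work i) phi) ->
  (forall i : 'I_4, (i < 3)%N -> blind (work i) psi) ->
  cost c0 phi m -> cost c0 psi n ->
  cost c0 (fun x => phi x && psi x) (8 * m + 4 * n + 16).
Proof.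
move=> ip iq pm pn.
have [ip0 ip1 ip2] : [/\ blind c0 phi, blind c1 phi & blind c2 phi].
  by split; exact: ip.
have [iq0 iq2] : blind c0 psi /\ blind c2 psi by split; exact: iq.
have p1 := cost_transfer (t := c1) isT ip0 ip1 pm.
have q2 := cost_transfer (t := c2) isT iq0 iq2 pn.
have g : cost c0 (fun x => bit c2 x && bit c1 (view x 0)) 1.
  have : cost c0 (fun x => bit c2 x && bit c1 x) 1.
    apply: cost_gen => //.
    - by apply: (@blind2 _ _ _ _ _ andb); exact: blind_bit.
    - by apply: (@finitary2 _ _ andb); exact: finitary_bit.
    - by rewrite !mem_cat inE eqxx !orbT.
  by apply: cost_ext => x _; rewrite view0.
have b20 : blind c0 (bit c2) by exact: blind_bit.
have b21 : blind c1 (bit c2) by exact: blind_bit.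
have s1 := cost_and a01 gensK (t := c0) (c := c1) isT b20 b21 ip0 ip1 g p1.
have g2 : cost c0 (fun x => phi x && bit c2 (view x 0)) (2 * (2 * m.+1 + 1)).
  by apply: cost_ext s1 => x mx; rewrite !view0 mx /= andbC.
have s2 := cost_and a01 gensK (t := c0) (c := c2) isT ip0 ip2 iq0 iq2 g2 q2.
apply: cost_leq (cost_ext _ s2) => [|x mx]; last by rewrite view0 mx.
by lia.
Qed.

Lemma cost_shift b k phi n : blind c0 phi -> blind c1 phi -> cost c0 phi n ->
  cost c0 (fun x => marked (view x (sstep b k)) && phi (view x (sstep b k)))
    (2 * (2 * n.+1 + 1)).
Proof.
move=> i0 i1 pn; have p1 := cost_transfer (t := c1) isT i0 i1 pn.
have g : cost c0 (fun x => true && bit c1 (view x (sstep b k))) 1.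
  apply: cost_gen => //; [exact: blind_view_bit|exact: finitary_view_bit|].
  rewrite !mem_cat; apply/orP; right; apply/orP; right; apply/orP; right.
  by apply/allpairsP; exists (b, k); split; rewrite ?mem_enum.
exact: (cost_and a01 gensK (t := c0) (c := c1) isT (blind_true _)
  (blind_true _) i0 i1 g p1).
Qed.

(* Checking a [k]-dimensional box costs only [O(n)]: a line of ancilla bits is
   required to be all 0, and to become all 1 once each of them is toggled by the
   check of the [(k-1)]-dimensional box based there. *)
Fixpoint box_check (n : nat) (ks : seq 'I_D.+1) x :=
  if ks is k :: ks' then line (anc_bit true k) (step k) n x &&
    line (anc_bit false k) (step k) n (toggle (anc k) (box_check n ks') x)
  else face_rule x.

Lemma blind_box_check n ks (v : 'I_4 + 'I_D.+1) :
  (forall k, k \in ks -> v != inr k) -> blind (inl v) (box_check n ks).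
Proof.
elim: ks => [|k ks IH] vk /=; first exact: blind_face_rule.
have nvk : inl v != anc k by apply: vk; rewrite mem_head.
have {}IH : blind (inl v) (box_check n ks).
  by apply: IH => l lks; apply: vk; rewrite inE lks orbT.
apply: (@blind2 _ _ _ _ _ andb).
  by apply: blind_line => //; exact: blind_anc_bit.
apply: (@blind_neutral _ _ _ _ _ _ (toggle (anc k) (box_check n ks))
  (line (anc_bit false k) (step k) n)).
  exact: neutral_toggle.
by apply: blind_line => //; exact: blind_anc_bit.
Qed.

Lemma cost_anc_line b k m :
  cost c0 (line (anc_bit b k) (step k) (2 ^ m).-1) (12 * 2 ^ m).
Proof.
apply: (cost_line a01 gensK (c1 := c1) (c2 := c2)) => //;
  try exact: blind_anc_bit; try exact: finitary_anc_bit.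
- rewrite !mem_cat; apply/orP; right; apply/orP; right; apply/orP; left.
  by apply/allpairsP; exists (b, k); split; rewrite ?mem_enum.
- by rewrite !mem_cat !inE eqxx !orbT.
- by rewrite !mem_cat !inE eqxx !orbT.
- by rewrite !mem_cat !inE eqxx !orbT.
Qed.

Lemma cost_box_check ks : uniq ks ->
  exists C, forall m, cost c0 (box_check (2 ^ m).-1 ks) (C * 2 ^ m).
Proof.
elim: ks => [|k ks IH] /=.
  move=> _; exists 1%N => m.
  apply: (@cost_leq _ _ _ _ _ _ _ _ 1); first by rewrite mul1n expn_gt0.
  apply: cost_gen => //; [exact: blind_face_rule|exact: finitary_face_rule|].
  by rewrite !mem_cat !inE eqxx !orbT.
move=> /andP[kks uks]; have [C CP] := IH uks.
(* A line costs [12 * 2 ^ m]; the ancilla toggle, of length at most [2 * (C + 1) * 2 ^ m], is paid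
   on both sides of the second line. The factors 8, 4 and 16 are those of [cost_prod]. *)
exists (8 * 12 + 4 * (12 + 2 * (2 * (C + 1))) + 16)%N => m.
set n := (2 ^ m).-1; have iw (i : 'I_4) : blind (work i) (box_check n ks).
  by apply: blind_box_check => l.
have ik : blind (anc k) (box_check n ks).
  by apply: blind_box_check => l lks; apply: contraNneq kks => -[->].
have [g [gw gE]] := cost_transfer (t := anc k) isT (iw _) ik (CP m).
have ng i : neutral (work i) g.
  by move=> S x; rewrite !gE; exact: neutral_toggle.
have il b i : blind (work i) (line (anc_bit b k) (step k) n).
  by apply: blind_line => //; exact: blind_anc_bit.
have H := cost_conj gensK (ng _) gw (cost_anc_line false k m).
have i2 i : blind (work i) (line (anc_bit false k) (step k) n \o g).
  by apply: blind_neutral => //; exact: il.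
apply: cost_leq (cost_ext _ (cost_prod (fun i _ => il true i) (fun i _ => i2 i)
  (cost_anc_line true k m) H)).
  have := expn_gt0 2 m; lia.
by move=> x _ /=; rewrite gE.
Qed.

Definition box n x := corner x && box_check n (enum 'I_D.+1) x.

Lemma blind_box n i : blind (work i) (box n).
Proof.
apply: (@blind2 _ _ _ _ _ andb); first exact: blind_corner.
exact: blind_box_check.
Qed.

Lemma cost_box : exists C, forall m, cost c0 (box (2 ^ m).-1) (C * 2 ^ m).
Proof.
have [C CP] := cost_box_check (enum_uniq 'I_D.+1).
exists (8 + 4 * C + 16)%N => m.
have gc : cost c0 corner 1.
  apply: cost_gen => //; [exact: blind_corner|exact: finitary_corner|].
  by rewrite !mem_cat !inE eqxx !orbT.
apply: cost_leq (cost_prod _ _ gc (CP m)) => [|i _|i _].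
- by have := expn_gt0 2 m; lia.
- exact: blind_corner.
- exact: blind_box_check.
Qed.

(** * Geometry of boxes *)

Implicit Types t v w : 'I_D.+1 -> nat.

Definition pos t : G := \sum_k step k *+ t k.

Lemma pos0 : pos (fun=> 0%N) = 0.
Proof. by apply: big1 => k _; rewrite mulr0n. Qed.

Lemma posD t v : pos (fun k => t k + v k)%N = pos t + pos v.
Proof. by rewrite /pos -big_split; apply: eq_bigr => k _; rewrite mulrnDr. Qed.

Lemma pos_delta k i : pos (fun l => if l == k then i else 0%N) = step k *+ i.
Proof.
rewrite /pos (bigD1 k) //= eqxx big1 ?addr0 // => l /negPf->.
by rewrite mulr0n.
Qed.

Lemma pos_split t k : pos t = step k *+ t k + pos (fun l => if l == k then 0%N else t l).
Proof.
rewrite -(pos_delta k (t k)) -posD; congr pos; apply/funext => l.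
by case: eqP => [->|_]; rewrite ?addn0 ?add0n.
Qed.

Lemma pos_dec t k : (0 < t k)%N ->
  pos t = step k + pos (fun l => if l == k then (t l).-1 else t l).
Proof.
move=> tk; rewrite -[step k]mulr1n -(pos_delta k 1) -posD; congr pos.
apply/funext => l; case: eqP => [->|_]; lia.
Qed.

Lemma line_at z e n x i : line z e n x -> (i < n)%N ->
  marked (view x (e *+ i)) && z (view x (e *+ i)).
Proof.
elim: n x i => // n IH x [|i] /= /and3P[mx zx lx].
  by rewrite mulr0n view0 mx zx.
by rewrite ltnS => /(IH _ _ lx); rewrite view_view mulrS.
Qed.

Lemma line_intro z e n x : (forall i, (i <= n)%N ->
  marked (view x (e *+ i)) && z (view x (e *+ i))) -> line z e n x.
Proof.
elim: n x => [|n IH] x xz; have := xz 0%N isT; rewrite mulr0n view0 => /andP[mx zx] //=.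
rewrite mx zx IH // => i iN; rewrite view_view -mulrS; exact: xz.
Qed.

(** An ancilla that is 0 and becomes 1 under the toggle certifies the lower-dimensional check at its
    cell, so coordinates are peeled off one direction at a time. *)
Lemma box_check_face_rule n ks x t : box_check n ks x -> (forall k, (t k < n)%N) ->
  (forall k, k \notin ks -> t k = 0%N) -> face_rule (view x (pos t)).
Proof.
elim: ks x t => [|k ks IH] x t /=.
  move=> zx _ t0; rewrite (_ : t = fun=> 0%N) ?pos0 ?view0 //.
  by apply/funext => k; exact: t0.
move=> /andP[l1 l2] tn t0; rewrite (pos_split t k) -view_view; apply: IH.
- have /andP[_] := line_at l1 (tn k); rewrite /anc_bit addbT => na.
  have /andP[_] := line_at l2 (tn k); rewrite /anc_bit addbF bit_toggle // (negPf na).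
  by rewrite eqxx /= => /andP[].
- by move=> l; case: eqP => [_|_]; [exact: leq_ltn_trans (tn k)|].
- move=> l lks; case: eqP => // /eqP lk; apply: t0.
  by rewrite inE negb_or lk.
Qed.

Lemma box_face_rule n x t : box n x -> (forall k, (t k < n)%N) -> face_rule (view x (pos t)).
Proof.
by move=> /andP[_ xn] tn; apply: box_check_face_rule xn tn _ => k; rewrite mem_enum.
Qed.

Lemma box_marked n x t : box n x -> (forall k, (t k < n)%N) -> marked (view x (pos t)).
Proof. by move=> /box_face_rule xn /xn/andP[]. Qed.

Lemma box_face n x t i : box n x -> (forall k, (t k < n)%N) ->
  bit (face i) (view x (pos t)) = (t i == 0%N).
Proof.
move=> xn; have [s ts] := ubnP (\sum_k t k)%N.
elim: s t ts => // s IH t ts tn.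
(* At the corner all face bits are set. Otherwise the face rule at the predecessor along [k] clears
   [face k] and preserves the other face bits. *)
have [k tk|t0] := pickP (fun k => 0 < t k)%N; last first.
  rewrite (_ : t = fun=> 0%N) ?pos0 ?view0 ?eqxx.
    by have /andP[/forallP/(_ i)] := xn.
  by apply/funext => k; apply/eqP; rewrite -leqn0 leqNgt t0.
rewrite (pos_dec tk); set t' := fun l => _.
have t'n l : (t' l < n)%N.
  by rewrite /t'; case: ifP => // _; exact: leq_ltn_trans (leq_pred _) (tn l).
have /andP[_ /forallP/(_ i)/andP[]] := box_face_rule xn t'n; rewrite !view_view.
have [<-|ki] := eqVneq k i.
  by move=> /negPf; rewrite addrC => -> _; rewrite eqn0Ngt tk.
move=> _ /forallP/(_ k); rewrite (negPf ki) view_view addrC => /eqP->; rewrite IH //.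
  by rewrite /t' [i == k]eq_sym (negPf ki).
move: ts; rewrite (bigD1 k) //= (bigD1 k (F := t')) //= {1}/t' eqxx.
rewrite (_ : \sum_(l | l != k) t' l = \sum_(l | l != k) t l)%N; last first.
  by apply: eq_bigr => l /negPf lk; rewrite /t' lk.
by case: (t k) tk => // p _; rewrite addSn.
Qed.

(** With truncated subtraction, both boxes contain the cell at [w - v] in the first and at [v - w]
    in the second. Its face bits make [w i - v i] and [v i - w i] vanish together, which forces
    [v i = w i]. *)
Lemma box_disjoint n x v w : (forall k, (v k < n)%N) -> (forall k, (w k < n)%N) ->
  box n x -> box n (view x (pos w - pos v)) -> v = w.
Proof.
move=> vn wn b1 b2; apply/funext => i.
have wvn k : (w k - v k < n)%N by exact: leq_ltn_trans (leq_subr _ _) (wn k).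
have vwn k : (v k - w k < n)%N by exact: leq_ltn_trans (leq_subr _ _) (vn k).
have := box_face i b2 vwn; rewrite view_view.
have -> : pos w - pos v + pos (fun k => v k - w k)%N = pos (fun k => w k - v k)%N.
  apply/eqP; rewrite addrAC subr_eq -!posD; apply/eqP; congr pos.
  by apply/funext => k; lia.
by rewrite (box_face i b1 wvn); lia.
Qed.

Definition spos (b : bool) t : G := if b then pos t else - pos t.

(* The mask [M] expresses that the path followed to [v] consists of marked cells. *)
Lemma cost_spos (b : bool) v (phi : X -> bool) n :
  blind c0 phi -> blind c1 phi -> cost c0 phi n ->
  exists m (M : X -> bool), [/\ forall j, blind j M,
    forall x, (forall t, (forall k, t k <= v k)%N -> marked (view x (spos b t))) -> M x
    & cost c0 (fun x => M x && phi (view x (spos b v))) m].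
Proof.
move=> i0 i1 pn; have [s vs] := ubnP (\sum_k v k)%N.
elim: s v vs => // s IH v vs.
have [k vk|v0] := pickP (fun k => 0 < v k)%N; last first.
  exists n, (fun=> true); split=> //; apply: cost_ext pn => x _.
  rewrite (_ : v = fun=> 0%N) ?/spos ?pos0 ?oppr0; first by case: (b); rewrite view0.
  by apply/funext => k; apply/eqP; rewrite -leqn0 leqNgt v0.
set v' := fun l => if l == k then (v l).-1 else v l.
have [|m [M [iM xM rM]]] := IH v'.
  move: vs; rewrite (bigD1 k) //= (bigD1 k (F := v')) //= {1}/v' eqxx.
  rewrite (_ : \sum_(l | l != k) v' l = \sum_(l | l != k) v l)%N; last first.
    by apply: eq_bigr => l /negPf lk; rewrite /v' lk.
  by case: (v k) vk => // p _; rewrite addSn.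
have insw i : blind (work i) phi -> blind (work i) (fun x => M x && phi (view x (spos b v'))).
  move=> ip; apply: (@blind2 _ _ _ _ _ andb); first exact: iM.
  exact: blind_view.
have rS := cost_shift b k (insw _ i0) (insw _ i1) rM.
have sk t : spos b (fun l => (l == k) + t l)%N = sstep b k + spos b t.
  rewrite /spos /sstep posD -[step k]mulr1n -(pos_delta k 1).
  rewrite (_ : pos (fun l => _ == _ : nat) = pos (fun l => if l == k then 1 else 0)%N).
    by case: (b); rewrite ?opprD.
  by congr pos; apply/funext => l; case: eqP.
exists (2 * (2 * m.+1 + 1))%N, (fun x => marked (view x (sstep b k)) && M (view x (sstep b k))).
split.
- move=> j; apply: (@blind2 _ _ _ _ _ andb); apply: (blind_view (phi := _)) => //.
  exact: blind_marked.
- move=> x xv; apply/andP; split.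
    have := xv (fun l => (l == k) + 0)%N; rewrite sk /spos pos0 oppr0.
    case: (b); rewrite addr0; apply => l; rewrite addn0; by case: eqP => [->|].
  apply: xM => t tv; rewrite view_view -sk; apply: xv => l.
  have := tv l; rewrite /v'; case: eqP => [->|_]; lia.
- apply: cost_ext rS => x _; rewrite -andbA view_view -sk.
  rewrite (_ : (fun l => _) = v) //; apply/funext => l; rewrite /v'.
  by case: eqP => [->|_] //; lia.
Qed.

Lemma posE t k : pos t 0 k = (t k * blen T)%N.
Proof.
rewrite /pos summxE (bigD1 k) //= big1 => [|l /negPf lk]; last first.
  by rewrite !mulmxnE !mxE eq_sym lk !mul0rn.
by rewrite !mulmxnE !mxE !eqxx addr0 -mulrnA -[LHS]/((blen T * t k)%:R) natz mulnC.
Qed.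

(* Every lattice point [pos t] is marked and all ancillas are 0; the face bit [i]
   is set where the i-th block coordinate is 0. *)
Definition x0 : X := fun q =>
  let o := `|(q 0%R 0%R %% (blen T)%:Z)%Z|%N in
  if (o <= 1)%N || [exists i, (o == off (face i)) && ((q 0%R i %/ (blen T)%:Z)%Z == 0)]
  then a1 else a0.

Lemma x0E t o : (o < blen T)%N -> x0 (pos t + cell D o) =
  if (o <= 1)%N || [exists i, (o == off (face i)) && (t i == 0%N)] then a1 else a0.
Proof.
move=> oK; have cE k : (pos t + cell D o) 0 k = (t k * blen T + (k == 0%R) * o)%N.
  rewrite mxE posE /cell mulmxnE mxE eqxx /= PoszD; congr (_ + _).
  by case: (k == 0); rewrite ?mul0rn // mul1n -[LHS]/(o%:R) natz.
have K0 : (0 < blen T)%N by exact: leq_ltn_trans oK.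
have divE k : ((pos t + cell D o) 0%R k %/ (blen T)%:Z)%Z = t k.
  rewrite cE divz_nat divnMDl // divn_small ?addn0 //.
  by case: (k == 0); rewrite ?mul0n ?mul1n.
have modE : `|((pos t + cell D o) 0%R 0%R %% (blen T)%:Z)%Z|%N = o.
  by rewrite cE modz_nat /= mul1n modnMDl modn_small.
rewrite /x0 modE; congr (if _ || _ then _ else _).
by apply: eq_existsb => i; rewrite divE.
Qed.

Lemma marked_x0 t : marked (view x0 (pos t)).
Proof.
rewrite /marked /view; apply/and4P; split.
- by rewrite -(cell0 D) x0E // /blen addnC.
- by rewrite x0E // /blen addnC.
- apply/forallP => i; rewrite x0E; last by rewrite /blen; have := ltn_ord i; lia.
  rewrite ifF // addn2 /=; apply/existsP => -[k /andP[/eqP + _]].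
  by rewrite /off; lia.
- apply/forallP => j; rewrite x0E; last exact: (@off_lt T).
  by case: ifP => _; rewrite !inE eqxx ?orbT.
Qed.

Lemma bit_x0 j t : bit j (view x0 (pos t)) = if j is inr i then t i == 0%N else false.
Proof.
rewrite /bit marked_x0 /view x0E /=; last exact: (@off_lt T).
rewrite (_ : (off j <= 1)%N = false) /=; last by rewrite /off; lia.
case: j => [v|i].
  rewrite ifF ?(negPf a01) //; apply/existsP => -[k /andP[/eqP/off_inj]].
  by [].
have -> : [exists k, (off (inr i : T) == off (face k)) && (t k == 0%N)] = (t i == 0%N).
  apply/existsP/idP => [[k /andP[/eqP/off_inj[->]]] //|ti].
  by exists i; rewrite eqxx.
by case: ifP; rewrite ?eqxx ?(negPf a01).
Qed.

Lemma x0_step t k i : view (view x0 (pos t)) (step k *+ i) =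
  view x0 (pos (fun l => t l + (if l == k then i else 0))%N).
Proof. by rewrite view_view posD pos_delta. Qed.

Lemma face_rule_x0 t : face_rule (view x0 (pos t)).
Proof.
rewrite /face_rule marked_x0; apply/forallP => i; rewrite -[step i]mulr1n x0_step bit_x0 /=.
rewrite eqxx addn1 /=; apply/forallP => k; rewrite -[step k]mulr1n x0_step !bit_x0 /=.
by rewrite eq_sym; case: eqP => //= _; rewrite addn0.
Qed.

Lemma box_check_x0 n ks t : box_check n ks (view x0 (pos t)).
Proof.
elim: ks t => [|k ks IH] t /=; first exact: face_rule_x0.
apply/andP; split; apply: line_intro => i _.
  by rewrite x0_step marked_x0 /anc_bit bit_x0.
rewrite marked_toggle // /anc_bit bit_toggle // x0_step marked_x0 bit_x0 eqxx /= IH.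
by [].
Qed.

Lemma box_x0 n : box n x0.
Proof.
rewrite /box -(view0 x0) -pos0 box_check_x0 andbT; apply/forallP => i.
by rewrite bit_x0.
Qed.

(** * Heisenberg families from boxes *)

Lemma toggleC i j phi psi x : blind i psi -> blind j phi ->
  toggle i phi (toggle j psi x) = toggle j psi (toggle i phi x).
Proof.
move=> ip jp.
have -> : toggle j psi (toggle i phi x) = flip i (fun p => phi (view x p)) (toggle j psi x).
  exact: (neutral_toggle a01 j ip).
by apply: flip_ext => p _; rewrite view_toggle //; exact: jp.
Qed.

Section Sites.
Variables (n m0 : nat).
Hypothesis cost_n : cost c0 (box n) m0.

Lemma cost_writer v : (forall k, (v k < n)%N) -> exists m xi,
  [/\ blind c0 xi, blind u xi, cost u xi m,
      forall y, xi y -> box n (view y (- pos v)) &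
      forall x, box n x -> xi (view x (pos v))].
Proof.
move=> vn.
have [m [M [iM xM rM]]] := cost_spos false v (blind_box n _) (blind_box n _) cost_n.
have ix i : blind (work i) (fun x => M x && box n (view x (spos false v))).
  by apply: (@blind2 _ _ _ _ _ andb) => //; exact/blind_view/blind_box.
exists (2 * m.+1)%N, (fun x => M x && box n (view x (spos false v))); split=> //.
- exact: (cost_transfer).
- by move=> y /andP[].
- move=> x bx; rewrite view_view subrr view0 bx andbT; apply: xM => t tv.
  rewrite view_view /spos (_ : pos v - pos t = pos (fun k => v k - t k)%N).
    by apply: (box_marked bx) => k; exact: leq_ltn_trans (leq_subr _ _) (vn k).
  apply/eqP; rewrite subr_eq -posD; apply/eqP; congr pos; apply/funext => k.
  by rewrite subnK.
Qed.

(** These are the [Z_v], which read track [u] at a site and write at the corner of its box. *)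
Lemma cost_reader w : (forall k, (w k < n)%N) -> exists m (M : X -> bool),
  [/\ forall j, blind j M, forall x, box n x -> M x &
      cost c0 (fun x => box n x && (M x && bit u (view x (pos w)))) m].
Proof.
move=> wn.
have [|||m [M [iM xM rM]]] := cost_spos true w (phi := bit u) (n := 1).
- exact: blind_bit.
- exact: blind_bit.
- apply: cost_gen => //; [exact: blind_bit|exact: finitary_bit|].
  by rewrite !mem_cat !inE eqxx !orbT.
exists (8 * m0 + 4 * m + 16)%N, M; split=> //.
- move=> x bx; apply: xM => t tw; apply: (box_marked bx) => k.
  exact: leq_ltn_trans (tw k) (wn k).
- apply: (cost_prod) => // i i3; first exact: blind_box.
  apply: (@blind2 _ _ _ _ _ andb) => //; apply: blind_view_bit => //.
  by apply: contraTneq i3 => -[->].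
Qed.

End Sites.

(** Only the length of the center is controlled; for the other members it is enough to lie in the
    generated subgroup. *)
Lemma heisenberg_sites n m0 : cost c0 (box n) m0 ->
  exists (Xf Zf : 'I_(n ^ D.+1) -> RCA A G) g,
  [/\ word gens m0 g, g != 1%g, heisenberg Xf Zf g,
      forall i, exists m, word gens m (Xf i) & forall i, exists m, word gens m (Zf i)].
Proof.
move=> rn; pose V := {ffun 'I_D.+1 -> 'I_n}.
have eV : (n ^ D.+1 = #|{: V}|)%N by rewrite card_ffun !card_ord.
pose site (i : 'I_(n ^ D.+1)) : 'I_D.+1 -> nat :=
  fun k => (enum_val (cast_ord eV i) : V) k.
have siteN i k : (site i k < n)%N by exact: ltn_ord.
have site_inj : injective site.
  move=> i i' ij; apply: (@cast_ord_inj _ _ eV); apply: enum_val_inj; apply/ffunP => k.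
  by apply/val_inj; exact: (congr1 (fun f : 'I_D.+1 -> nat => f k) ij).
have /choice[Wr WrP] : forall i, exists p : RCA A G * (X -> bool),
    [/\ blind c0 p.2, blind u p.2, p.1 =1 toggle u p.2, (exists m, word gens m p.1) &
     (forall y, p.2 y -> box n (view y (- pos (site i)))) /\
     (forall x, box n x -> p.2 (view x (pos (site i))))].
  move=> i; have [m [xi [i0 iu [g [gm gE]] xi1 xi2]]] := cost_writer rn (siteN i).
  by exists (g, xi); split=> //; exists m.
have /choice[Rd RdP] : forall i, exists p : RCA A G * (X -> bool),
    [/\ forall j, blind j p.2, forall x, box n x -> p.2 x,
      p.1 =1 toggle c0 (fun x => box n x && (p.2 x && bit u (view x (pos (site i))))) &
      exists m, word gens m p.1].
  move=> i; have [m [M [iM bM [g [gm gE]]]]] := cost_reader rn (siteN i).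
  by exists (g, M); split=> //; exists m.
have [g [gm gE]] := rn.
pose zeta i x := box n x && ((Rd i).2 x && bit u (view x (pos (site i)))).
have ib i : blind (work i) (box n) by exact: blind_box.
have iz i : blind c0 (zeta i).
  have [iM _ _ _] := RdP i.
  apply: (@blind2 _ _ _ _ _ andb) => //; apply: (@blind2 _ _ _ _ _ andb) => //.
  exact: blind_view_bit.
exists (fun i => (Wr i).1), (fun i => (Rd i).1), g; split => //.
(* [x0] has a box at the origin, so [g] flips [c0] there. *)
- apply/eqP => g1; have := gE x0; rewrite g1 => /(congr1 (fun x => bit c0 (view x 0))).
  have b0 : box n x0 by exact: box_x0.
  rewrite bit_toggle // view0 b0 eqxx /=.
  have : marked (view x0 (pos (fun=> 0%N))) by exact: marked_x0.
  by rewrite pos0 view0 => ->; case: (bit c0 x0).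
- split.
  + move=> i; have [_ iu XE _ _] := WrP i; apply/val_inj/funext => x /=.
    by rewrite !XE toggleK.
  + move=> i; have [_ _ ZE _] := RdP i; apply/val_inj/funext => x /=.
    by rewrite !ZE toggleK //; exact: iz.
  + by apply/val_inj/funext => x /=; rewrite !gE toggleK.
  + move=> i j; have [_ iu XE _ _] := WrP i; have [_ ju XE' _ _] := WrP j.
    apply/val_inj/funext => x /=; rewrite !XE !XE' !toggleD //.
    by apply: toggle_ext => y _; rewrite addbC.
  + move=> i j; have [_ _ ZE _] := RdP i; have [_ _ ZE' _] := RdP j.
    apply/val_inj/funext => x /=; rewrite !ZE !ZE' !toggleD //; try exact: iz.
    by apply: toggle_ext => y _; rewrite addbC.
  + move=> i; have [i0 iu XE _ _] := WrP i.
    by apply/val_inj/funext => x /=; rewrite ?XE ?gE ?XE ?gE toggleC.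
  + move=> i; have [_ _ ZE _] := RdP i.
    apply/val_inj/funext => x /=; rewrite ?ZE ?gE ?ZE ?gE !toggleD //; last exact: iz.
    by apply: toggle_ext => y _; rewrite addbC.
  + move=> i j; have [i0 iu XE _ [xi1 xi2]] := WrP i; have [iM bM ZE _] := RdP j.
    set d := i == j; pose gd : X -> bool := fun x => d && box n x.
    have gdE x : (if d then g else 1%g) x = toggle c0 gd x.
      case: {+}d @gd => /=; first exact: gE.
      by apply/esym; exact: flip0.
    have igd k : blind (work k) gd by move=> S x; rewrite /gd ib.
    apply/val_inj/funext => x /=; rewrite ZE XE gdE ZE XE.
    rewrite -(toggleC _ (phi := gd)) // toggleD; last exact: iz.
    rewrite (neutral_toggle a01 _ i0) /toggle.
    rewrite -/(toggle _ _ _); apply: flip_ext => p mp.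
    rewrite !view_toggle // in mp *; move: (view x p) mp => y my {x p}.
    set q := pos (site j); have -> : gd (toggle u (Wr i).2 y) = gd y by exact: (igd _ _ y).
    have -> : box n (toggle u (Wr i).2 y) = box n y by exact: ib.
    rewrite (_ : (Rd j).2 (toggle u (Wr i).2 y) = (Rd j).2 y); last exact: iM.
    rewrite -[toggle u _ (view y q)]view0 bit_toggle // view0 eqxx /= /gd.
    case by_ : (box n y); last by rewrite andbF.
    rewrite bM // (box_marked by_) //= andbT -addbA; apply/esym.
    (* Writer [i] acts at [q] only for a box with corner at [q - pos (site i)]; disjointness from
       the box of [y] forces [i = j]. *)
    rewrite (_ : (Wr i).2 (view y q) = d) ?addbb ?addbF // /d.
    apply/idP/eqP => [/xi1|ij]; last by rewrite /q -ij; exact: xi2.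
    rewrite view_view => bq; apply: site_inj.
    by apply: (box_disjoint _ _ by_ bq).
  exact: a01.
- by move=> i; have [] := WrP i.
- by move=> i; have [] := RdP i.
Qed.

End Boxes.

(** * The subgroup generated by the gates does not embed *)

Theorem theorem6 (D d : nat) (hd : (0 < d)%N) (hD : (d < D)%N)
    (A B : finType) (hA : (1 < #|A|)%N) (hB : (1 < #|B|)%N) :
  exists (P : pred (RCA A 'rV[int]_D)) (H : subGroupType P),
    finitely_generated H /\ ~ embeds H (RCA B 'rV[int]_d).
Proof.
case: D hD => // D hD; have /card_gt1P[a0 [a1 [_ _ a01]]] := hA.
have [C CP] := cost_box D a01; pose S := gens a0 a1 D.
exists (in_gen S), (gen_group S : subGroupType _); split; first exact: gen_group_fg.
(* [C'] comes from the images of the generators under the supposed embedding; [m] is chosen after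
   [C] and [C'], so the rank bound fails at [n = C * 2 ^ m]. *)
move=> [f finj]; have [C' SC'] := heisenberg_rank_bound (map f (pmap insub S)).
have [m] := rank_bound_fails #|B| C C' hd hD; rewrite ltnNge => /negP[].
have [X [Z [g [gS g1 H XS ZS]]]] := heisenberg_sites a01 (CP m).
have X' i : {x : gen_group S | val x = X i}.
  apply: cid; have [n /word_in_gen XiS] := XS i.
  by exists (Sub (X i) XiS); rewrite SubK.
have Z' i : {x : gen_group S | val x = Z i}.
  apply: cid; have [n /word_in_gen ZiS] := ZS i.
  by exists (Sub (Z i) ZiS); rewrite SubK.
pose g' : gen_group S := Sub g (word_in_gen gS).
apply: (SC' _ _ (f \o (fun i => sval (X' i))) (f \o (fun i => sval (Z' i))) (f g')).
- by apply: word_morph; apply: word_lift.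
(* Injectivity of [f] keeps the image of the center nontrivial. *)
- apply: contraNneq g1 => fg; have : g' = 1%g by apply: finj; rewrite fg morph1.
  by move/(congr1 val); rewrite SubK => ->; apply/eqP.
- apply: heisenberg_morph; case: H => XX ZZ gg XC ZC gX gZ XZ.
  have X'E i : val (sval (X' i)) = X i by exact: svalP (X' i).
  have Z'E i : val (sval (Z' i)) = Z i by exact: svalP (Z' i).
  split=> *; apply/val_inj; rewrite ?[val (_ * _)%g]valM ?[val _]X'E ?[val _]Z'E.
  all: rewrite ?X'E ?Z'E //=.
  all: try by [rewrite XX|rewrite ZZ|rewrite XC|rewrite ZC|rewrite gX|rewrite gZ].
  by rewrite ?X'E ?Z'E ?XZ; case: ifP.
Qed.
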